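(* Let $T$ be an o-minimal expansion of $\mathsf{RCF}$ (the theory of real closed fields), with monster model $\mathfrak U$. Then all non-realised definable types are domination-equivalent, and $\widetilde{\mathrm{Def}}(\mathfrak U)$ is a monoid and isomorphic to $(\mathscr P(\{0\}),\cup,\supseteq)$.
   Context: $T$ is a complete first-order theory, $\mathfrak U=(U,\dots)$ a monster model, i.e. $\kappa$-saturated and $\kappa$-strongly homogeneous for a fixed strong limit cardinal $\kappa>|T|$; small means of size $<\kappa$. $S^{\mathrm{inv}}(U)$ is the set of types over $U$ in finitely many variables fixed by $\mathrm{Aut}(\mathfrak U/A)$ for some small $A\subseteq U$ ($A$-invariant types). A type $p(x)$ over $U$ is definable if for some small $A\subseteq U$ and every formula $\varphi(x,y)$ over $\emptyset$ the set $\{d\in U^{|y|}:\varphi(x,d)\in p\}$ is definable over $A$; such types are invariant. A type over $U$ is realised if it is realised in $U$. If $p(x)$ is $A$-invariant and $B\supseteq U$, then $p\mid B$ is the type over $B$ with $\varphi(x,b)\in p\mid B$ iff $\varphi(x,d)\in p$ for some (equivalently every) $d\in U$ with $d\equiv_A b$; $p(x)\otimes q(y)$ is: for $b\models q$, $\varphi(x,y)\in p\otimes q$ iff $\varphi(x,b)\in p\mid Ub$. Domination: for $p(x),q(y)\in S^{\mathrm{inv}}(U)$, $p\ge_D q$ means there are a small $A\subseteq U$ and a complete type $r(x,y)$ over $A$ extending $(p(x)\cup q(y))\restriction A$ with $p(x)\cup r(x,y)\vdash q(y)$. $p\sim_D q$ (domination-equivalence) means $p\ge_D q$ and $q\ge_D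 p$. $\widetilde{\mathrm{Def}}(\mathfrak U)$ is the set of $\sim_D$-classes of definable types, ordered by $\ge_D$; it ''is a monoid'' if $\otimes$ is compatible with $\ge_D$ on definable types ($p_0\ge_D p_1$ implies $q\otimes p_0\ge_D q\otimes p_1$), so that $\otimes$ induces a monoid operation. The isomorphism takes $\otimes$ to $\cup$ and $\ge_D$ to $\supseteq$. *)

(* Defs.v *)
From HB Require Import structures.
From mathcomp Require Import all_boot all_order all_algebra.
From mathcomp Require Import boolp classical_sets functions cardinality.

Set Implicit Arguments.
Unset Strict Implicit.
Unset Printing Implicit Defensive.
Import Order.TTheory GRing.Theory Num.Theory.
Local Open Scope classical_set_scope.

(** * First-order logic *)

Record language := Language {
  fsym : nat -> Type;   (* function symbols by arity; constants have arity 0 *)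
  rsym : nat -> Type    (* relation symbols by arity *)
}.

Record structure (L : language) := Structure {
  carrier :> Type;
  finterp : forall k, fsym L k -> ('I_k -> carrier) -> carrier;
  rinterp : forall k, rsym L k -> ('I_k -> carrier) -> Prop
}.

Inductive term (L : language) (V : Type) : Type :=
| Var of V
| App k of fsym L k & ('I_k -> term L V).

(* Formulas whose free variables are taken in [V]; in the scope of a
   quantifier the bound variable is [None : option V]. *)
Inductive formula (L : language) (V : Type) : Type :=
| Bot
| Equ of term L V & term L V
| Rel k of rsym L k & ('I_k -> term L V)
| Imp of formula L V & formula L V
| All of formula L (option V).

Arguments Bot {L V}.

Definition Neg L V (phi : formula L V) : formula L V := Imp phi Bot.

Definition sentence (L : language) := formula L void.

Fixpoint trename L V W (f : V -> W) (t : term L V) : term L W :=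
  match t with
  | Var x => Var L (f x)
  | App k s ts => App s (fun i => trename f (ts i))
  end.

Fixpoint rename L V W (f : V -> W) (phi : formula L V) : formula L W :=
  match phi with
  | Bot => Bot
  | Equ t1 t2 => Equ (trename f t1) (trename f t2)
  | Rel k s ts => Rel s (fun i => trename f (ts i))
  | Imp phi1 phi2 => Imp (rename f phi1) (rename f phi2)
  | All phi1 => All (rename (option_map f) phi1)
  end.

Fixpoint teval L (M : structure L) V (v : V -> M) (t : term L V) : M :=
  match t with
  | Var x => v x
  | App k s ts => finterp s (fun i => teval v (ts i))
  end.

Fixpoint sat L (M : structure L) V (v : V -> M) (phi : formula L V) : Prop :=
  match phi with
  | Bot => False
  | Equ t1 t2 => teval v t1 = teval v t2
  | Rel k s ts => rinterp s (fun i => teval v (ts i))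
  | Imp phi1 phi2 => sat v phi1 -> sat v phi2
  | All phi1 => forall a : M, sat (oapp v a) phi1
  end.

Definition models L (M : structure L) (T : set (sentence L)) : Prop :=
  forall sigma, T sigma -> sat (of_void M) sigma.

Definition entails L (T : set (sentence L)) (sigma : sentence L) : Prop :=
  forall M : structure L, models M T -> sat (of_void M) sigma.

(* Consistency will always come from a given model. *)
Definition complete_theory L (T : set (sentence L)) : Prop :=
  forall sigma, entails T sigma \/ entails T (Neg sigma).

Definition same_type L (M N : structure L) P (c : P -> M) (d : P -> N) : Prop :=
  forall phi : formula L P, sat c phi <-> sat d phi.

Definition elementary L (M N : structure L) (e : M -> N) : Prop :=
  same_type (@id M) e.

Definition automorphism L (M : structure L) (s : M -> M) : Prop :=
  [/\ bijective s,
      forall k (f : fsym L k) (a : 'I_k -> M),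
        s (finterp f a) = finterp f (s \o a) &
      forall k (R : rsym L k) (a : 'I_k -> M),
        rinterp R a <-> rinterp R (s \o a)].

(** * Types

   A formula in the variables [V] with parameters named by [P] is a
   [formula L (V + P)]; parameters from [A : set M] are named by [A] itself,
   seen as a type. *)

Definition join V P X (a : V -> X) (c : P -> X) (z : V + P) : X :=
  match z with inl x => a x | inr u => c u end.

Definition vrename L V W P (f : V -> W) :
    formula L (V + P) -> formula L (W + P) :=
  rename (join (@inl W P \o f) (@inr W P)).

Definition prename L V P Q (f : P -> Q) :
    formula L (V + P) -> formula L (V + Q) :=
  rename (join (@inl V Q) (@inr V Q \o f)).

Definition realises L (M : structure L) V P (c : P -> M) (a : V -> M)
    (p : set (formula L (V + P))) : Prop :=
  forall phi, p phi -> sat (join a c) phi.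

Definition finitely_satisfiable L (M : structure L) V P (c : P -> M)
    (p : set (formula L (V + P))) : Prop :=
  forall F, finite_set F -> F `<=` p -> exists a : V -> M, realises c a F.

Definition complete_type L (M : structure L) V P (c : P -> M)
    (p : set (formula L (V + P))) : Prop :=
  finitely_satisfiable c p /\ forall phi, p phi \/ p (Neg phi).

Definition restrict L (M : structure L) V (A : set M)
    (p : set (formula L (V + M))) : set (formula L (V + A)) :=
  [set phi | p (prename (@set_val M A) phi)].

Arguments restrict {L M V} A p.

(** * Cardinals and monster models

   A cardinal is represented by a type [K] of that cardinality. *)

Definition card_lt X Y (A : set X) (B : set Y) : Prop :=
  (A #<= B)%card /\ ~ (B #<= A)%card.

Definition small (K : Type) X (A : set X) : Prop := card_lt A [set: K].

Definition strong_limit (K : Type) : Prop :=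
  forall X : set K, small K X -> small K [set Y : set K | Y `<=` X].

(* |T| is, as usual, the number of L-formulas, i.e. |L| + aleph_0. *)
Definition theory_small (K : Type) (L : language) : Prop :=
  small K [set: formula L nat].

Definition saturated (K : Type) L (M : structure L) : Prop :=
  forall (A : set M), small K A ->
  forall n (p : set (formula L ('I_n + A))),
    finitely_satisfiable (@set_val M A) p ->
    exists a : 'I_n -> M, realises (@set_val M A) a p.

Definition strongly_homogeneous (K : Type) L (M : structure L) : Prop :=
  forall (A : set M), small K A ->
  forall f : A -> M, same_type (@set_val M A) f ->
    exists s : M -> M, automorphism s /\ forall x : A, s (set_val x) = f x.

Definition monster (K : Type) L (U : structure L) : Prop :=
  [/\ strong_limit K, theory_small K L,
      saturated K U & strongly_homogeneous K U].

(** * Global types *)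

(* A set of L(U)-formulas in finitely many variables; being a complete type
   is a separate predicate. *)
Record gset L (U : structure L) := GSet {
  gdim : nat;
  gforms :> set (formula L ('I_gdim + U))
}.

Arguments gforms {L U}.

Section GlobalTypes.
Variables (K : Type) (L : language) (U : structure L).
Implicit Types p q r : gset U.

Definition global_type p : Prop := complete_type (@id U) p.

Definition invariant (A : set U) p : Prop :=
  forall s : U -> U, automorphism s -> (forall x, A x -> s x = x) ->
    forall phi, gforms p phi <-> gforms p (prename s phi).

Definition definable_over (A : set U) p : Prop :=
  forall m (phi : formula L ('I_(gdim p) + 'I_m)),
    exists psi : formula L ('I_m + A),
      forall d : 'I_m -> U,
        gforms p (prename d phi) <-> sat (join d (@set_val U A)) psi.

Definition definable_type : set (gset U) :=
  [set p | global_type p /\ exists A, small K A /\ definable_over A p].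

Definition realised p : Prop :=
  exists a : 'I_(gdim p) -> U, realises (@id U) a p.

(* [p | B], for [p] an [A]-invariant type and [B] a subset of an elementary
   extension [e : U -> N]. *)
Definition extension (A : set U) p (N : structure L) (e : U -> N) (B : set N) :
    set (formula L ('I_(gdim p) + N)) :=
  [set chi | exists k (phi : formula L ('I_(gdim p) + 'I_k))
                    (b : 'I_k -> N) (d : 'I_k -> U),
     [/\ forall i, B (b i),
         chi = prename b phi,
         same_type (join d (@set_val U A)) (join b (e \o @set_val U A)) &
         gforms p (prename d phi)]].

Arguments extension A p {N} e B.

(* From phi(x, y) over U to phi(x, b). *)
Definition subst_right n m (N : structure L) (e : U -> N) (b : 'I_m -> N) :
    formula L ('I_(n + m) + U) -> formula L ('I_n + N) :=
  rename (join (fun i => join (@inl 'I_n N) (@inr 'I_n N \o b) (fintype.split i))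
               (@inr 'I_n N \o e)).

(* [p(x) ⊗ q(y)]; the variables x come first.  The choice of the realisation
   [b] of [q] and of [A] is immaterial. *)
Definition tensor p q : gset U :=
  @GSet L U (gdim p + gdim q)
    [set phi | exists (N : structure L) (e : U -> N)
                      (b : 'I_(gdim q) -> N) (A : set U),
       [/\ elementary e, realises e b q, small K A, invariant A p &
           extension A p e (range e `|` range b) (subst_right e b phi)]].

(* Entailment is modulo the elementary diagram of U. *)
Definition dominates p q : Prop :=
  exists (A : set U)
         (r : set (formula L ('I_(gdim p) + 'I_(gdim q) + A))),
    [/\ small K A,
        complete_type (@set_val U A) r,
        forall phi, restrict A p phi -> r (vrename inl phi),
        forall phi, restrict A q phi -> r (vrename inr phi) &
        forall (N : structure L) (e : U -> N), elementary e ->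
        forall (a : 'I_(gdim p) -> N) (b : 'I_(gdim q) -> N),
          realises e a p -> realises (e \o @set_val U A) (join a b) r ->
          realises e b q].

Definition dom_equiv p q : Prop := dominates p q /\ dominates q p.

(** * The quotient of definable types by domination-equivalence *)

Definition dclass p : set (gset U) :=
  [set q | definable_type q /\ dom_equiv p q].

Definition Deftilde : set (set (gset U)) := dclass @` definable_type.

Definition cmul (X Y : set (gset U)) : set (gset U) :=
  [set r | definable_type r /\
     exists p q, [/\ X p, Y q & dom_equiv (tensor p q) r]].

Definition cge (X Y : set (gset U)) : Prop :=
  exists p q, [/\ X p, Y q & dominates p q].

Definition tensor_compatible : Prop :=
  forall q p0 p1, definable_type q -> definable_type p0 -> definable_type p1 ->
    dominates p0 p1 -> dominates (tensor q p0) (tensor q p1).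

Definition Deftilde_monoid : Prop :=
  [/\ tensor_compatible,
      forall p q, definable_type p -> definable_type q ->
        definable_type (tensor p q) /\
        cmul (dclass p) (dclass q) = dclass (tensor p q),
      forall X Y Z, Deftilde X -> Deftilde Y -> Deftilde Z ->
        cmul X (cmul Y Z) = cmul (cmul X Y) Z &
      exists2 E, Deftilde E &
        forall X, Deftilde X -> cmul E X = X /\ cmul X E = X].

Definition Deftilde_iso_powerset (f : set (gset U) -> set nat) : Prop :=
  [/\ set_bij Deftilde [set S | S `<=` [set 0%N]] f,
      forall X Y, Deftilde X -> Deftilde Y ->
        f (cmul X Y) = f X `|` f Y &
      forall X Y, Deftilde X -> Deftilde Y ->
        (cge X Y <-> f Y `<=` f X)].

End GlobalTypes.

(** * O-minimal expansions of real closed fields *)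

Record oring_symbols (L : language) := ORingSymbols {
  sym0 : fsym L 0;
  sym1 : fsym L 0;
  symN : fsym L 1;
  symD : fsym L 2;
  symM : fsym L 2;
  symlt : rsym L 2
}.

Section OMinimal.
Variables (L : language) (O : oring_symbols L).

Definition app0 X (i : 'I_0) : X := match notF (ltn_ord i) with end.
Definition app1 X (x : X) (i : 'I_1) : X := x.
Definition app2 X (x y : X) (i : 'I_2) : X := if i == ord0 then x else y.

Definition mlt (M : structure L) (x y : M) : Prop :=
  rinterp (symlt O) (app2 x y).

Definition real_closed_reduct (M : structure L) : Prop :=
  exists (R : rcfType) (f : M -> R), bijective f /\
    [/\ f (finterp (sym0 O) (@app0 M)) = 0%R,
        f (finterp (sym1 O) (@app0 M)) = 1%R,
        forall x, f (finterp (symN O) (app1 x)) = (- f x)%R,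
        forall x y, f (finterp (symD O) (app2 x y)) = (f x + f y)%R &
        forall x y, f (finterp (symM O) (app2 x y)) = (f x * f y)%R] /\
    forall x y, mlt x y <-> (f x < f y)%R.

Definition expands_RCF (T : set (sentence L)) : Prop :=
  forall M : structure L, models M T -> real_closed_reduct M.

(* [None] stands for the infinite endpoints. *)
Definition open_interval (M : structure L) (lo hi : option M) : set M :=
  [set x | (if lo is Some a then mlt a x else True) /\
           (if hi is Some b then mlt x b else True)].

Definition ominimal (M : structure L) : Prop :=
  forall phi : formula L ('I_1 + M), exists F : set (set M),
    [/\ finite_set F,
        forall I, F I -> (exists a, I = [set a]) \/
                         (exists lo hi, I = open_interval lo hi) &
        [set x | sat (join (app1 x) id) phi] = \bigcup_(I in F) I].

Definition ominimal_theory (T : set (sentence L)) : Prop :=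
  forall M : structure L, models M T -> ominimal M.

End OMinimal.

(* Main.v *)
Require Import Defs.
From mathcomp Require Import all_boot all_order all_algebra.
From mathcomp Require Import boolp classical_sets functions cardinality filter.
From mathcomp Require Import lra.

(* Domination between definable types turns out to depend only on whether they are
   realised; the point is that a non-realised definable type p(y) dominates every
   definable type q(x).  Let b realise p, let c realise the extension of q to a model
   containing b, and let r be the type of (b, c) over a small set A of definition.
   Suppose that R(c, b, z) is A-definable and has no solution z in U.  One finds an
   A-definable R'(y, z), implied by R(c, b, z) at b, that still has no solution in U
   at b; that R implies R' is then part of r, and that R'(b, -) misses U is part of p,
   so R(x, y, -) misses U for all realisations of p and r.  This is what q demands.

   The relation R' is built by induction on the length of z.  In one variable,
   o-minimality makes the set R(c, b, -) a finite union of intervals, each adherent to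
   at most one point of U or to an infinite end, and the set G of these points is
   A-definable because the type of (c, b) is.  So for every t in U the set
   R(c, b, -) lies in the A-definable neighbourhood of G and of infinity of radius 1/t,
   and these neighbourhoods have no common point in U.  A non-realised coordinate of b
   yields in the same way an infinite element definable from b, up to which t can then
   be chosen definably from b, because c is generic over b. *)

Set Implicit Arguments.
Unset Strict Implicit.
Unset Printing Implicit Defensive.
Import Order.TTheory GRing.Theory Num.Theory.
Local Open Scope classical_set_scope.

Lemma finite_set_ind T (P : set T -> Prop) :
  P set0 -> (forall x F, P F -> P (x |` F)) -> forall F, finite_set F -> P F.
Proof.
move=> P0 PU F hF; have [s ->] := (@finite_seqP {classic T} F).1 hF.
elim: s => [|x s IH]; first by rewrite set_nil.
rewrite (_ : [set` x :: s] = x |` [set` s]); first exact: PU.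
apply/seteqP; split=> y /=; rewrite inE; first by case/predU1P; [left|right].
by move=> h; apply/predU1P.
Qed.

(** * Formulas *)

Section Formulas.
Variable L : language.

Definition And V (phi psi : formula L V) : formula L V :=
  Neg (Imp phi (Neg psi)).

#[local] Arguments And : simpl never.
#[local] Arguments Neg : simpl never.

Lemma sat_neg (M : structure L) V (v : V -> M) phi :
  sat v (Neg phi) <-> ~ sat v phi.
Proof. by []. Qed.

Lemma sat_and (M : structure L) V (v : V -> M) phi psi :
  sat v (And phi psi) <-> sat v phi /\ sat v psi.
Proof.
split=> [h|[h1 h2] h3]; last exact: h3 h1 h2.
by split; apply: contrapT => h'; apply: h => /= h1 // h2; apply: h'.
Qed.

Lemma finite_conjunction V (F : set (formula L V)) : finite_set F ->
  exists psi : formula L V, forall (M : structure L) (v : V -> M),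
    sat v psi <-> forall phi, F phi -> sat v phi.
Proof.
move: F; apply: finite_set_ind => [|phi F [psi hpsi]].
  by exists (Neg Bot) => M v; split=> [_ phi|_] [].
exists (And phi psi) => M v; rewrite sat_and hpsi; split=> [[h1 h2] chi|h].
  by case=> [->|/h2].
by split=> [|chi hchi]; apply: h; [left|right].
Qed.

Lemma teval_trename (M : structure L) V W (f : V -> W) (w : W -> M) t :
  teval w (trename f t) = teval (w \o f) t.
Proof. by elim: t => //= k s ts IH; congr finterp; apply: funext. Qed.

Lemma oapp_comp (M : Type) V W (f : V -> W) (w : W -> M) a :
  oapp w a \o option_map f = oapp (w \o f) a.
Proof. by apply: funext; case. Qed.

Lemma sat_rename (M : structure L) V W (f : V -> W) (w : W -> M) phi :
  sat w (rename f phi) <-> sat (w \o f) phi.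
Proof.
elim: phi W f w => [V'|V' t1 t2|V' k s ts|V' phi IH1 psi IH2|V' phi IH] W f w //=.
- by rewrite !teval_trename.
- by under eq_fun do rewrite teval_trename.
- by rewrite IH1 IH2.
- by split=> h a; move: (h a); rewrite IH oapp_comp.
Qed.

Lemma trename_comp V W X (f : V -> W) (g : W -> X) (t : term L V) :
  trename g (trename f t) = trename (g \o f) t.
Proof. by elim: t => //= k s ts IH; congr App; apply: funext. Qed.

Lemma rename_comp V W X (f : V -> W) (g : W -> X) (phi : formula L V) :
  rename g (rename f phi) = rename (g \o f) phi.
Proof.
elim: phi W X f g => [V'|V' t1 t2|V' k s ts|V' phi IH1 psi IH2|V' phi IH] W X f g //=.
- by rewrite !trename_comp.
- by congr Rel; apply: funext => i; rewrite /= trename_comp.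
- by rewrite IH1 IH2.
- by rewrite IH; congr (All (rename _ _)); apply: funext; case.
Qed.

Lemma trename_id V (t : term L V) : trename id t = t.
Proof. by elim: t => //= k s ts IH; congr App; apply: funext. Qed.

Lemma rename_id V (phi : formula L V) : rename id phi = phi.
Proof.
elim: phi => [V'|V' t1 t2|V' k s ts|V' phi IH1 psi IH2|V' phi IH] //=.
- by rewrite !trename_id.
- by congr Rel; apply: funext => i; rewrite trename_id.
- by rewrite IH1 IH2.
- by rewrite -[in RHS]IH; congr (All (rename _ _)); apply: funext; case.
Qed.

Lemma join_comp V P X Y (a : V -> X) (c : P -> X) (h : X -> Y) :
  h \o join a c = join (h \o a) (h \o c).
Proof. by apply: funext; case. Qed.

Lemma sat_vrename (M : structure L) V W P (f : V -> W) (w : W -> M)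
    (c : P -> M) phi :
  sat (join w c) (vrename f phi) <-> sat (join (w \o f) c) phi.
Proof.
rewrite sat_rename (_ : _ \o _ = join (w \o f) c) //.
by apply: funext; case.
Qed.

Lemma sat_prename (M : structure L) V P Q (f : P -> Q) (v : V -> M)
    (c : Q -> M) phi :
  sat (join v c) (prename f phi) <-> sat (join v (c \o f)) phi.
Proof.
rewrite sat_rename (_ : _ \o _ = join v (c \o f)) //.
by apply: funext; case.
Qed.

Lemma prename_comp V P Q R (f : P -> Q) (g : Q -> R) (phi : formula L (V + P)) :
  prename g (prename f phi) = prename (g \o f) phi.
Proof. by rewrite /prename rename_comp; congr rename; apply: funext; case. Qed.

Lemma finite_support_term X (t : term L X) V W (h : X -> V + W) :
  exists (F : finType) (t0 : term L (V + F)) (g : F -> W),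
    trename h t = trename (join inl (inr \o g)) t0.
Proof.
elim: t => [x|k s ts IH].
  case E: (h x) => [v|w].
    by exists void, (Var L (inl v)), (of_void W); rewrite /= E.
  by exists unit, (Var L (inr tt)), (fun=> w); rewrite /= E.
pose F i := projT1 (cid (IH i)).
have /(_ _)/cid IH1 i := projT2 (cid (IH i)).
pose t0 i := projT1 (IH1 i); pose g i := projT1 (cid (projT2 (IH1 i))).
have IH' i : _ = trename _ (t0 i) := projT2 (cid (projT2 (IH1 i))).
exists {i : 'I_k & F i}.
exists (App s (fun i => trename (join inl (fun u => inr (existT _ i u))) (t0 i))).
exists (fun u => g (projT1 u) (projT2 u)) => /=.
congr App; apply: funext => i; apply: etrans (IH' i) _; rewrite trename_comp.
by congr trename; apply: funext; case.
Qed.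

(** The renaming [h] is arbitrary so that the induction passes under [All]: there the bound variable
    joins the kept variables [V], while the abstracted ones stay in [W]. *)
Lemma finite_support_fintype X (phi : formula L X) V W (h : X -> V + W) :
  exists (F : finType) (phi0 : formula L (V + F)) (g : F -> W),
    rename h phi = rename (join inl (inr \o g)) phi0.
Proof.
elim: phi V h => [X'|X' t1 t2|X' k s ts|X' phi IH1 psi IH2|X' phi IH] V h.
- by exists void, Bot, (of_void W).
- have [F1 [u1 [g1 e1]]] := finite_support_term t1 h.
  have [F2 [u2 [g2 e2]]] := finite_support_term t2 h.
  exists (F1 + F2)%type.
  exists (Equ (trename (join inl (inr \o inl)) u1)
              (trename (join inl (inr \o inr)) u2)), (join g1 g2) => /=.
  rewrite e1 e2 !trename_comp.
  by congr Equ; congr trename; apply: funext; case.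
- have IH i := finite_support_term (ts i) h.
  pose F i := projT1 (cid (IH i)).
  have /(_ _)/cid IH1 i := projT2 (cid (IH i)).
  pose t0 i := projT1 (IH1 i); pose g i := projT1 (cid (projT2 (IH1 i))).
  have IH' i : _ = trename _ (t0 i) := projT2 (cid (projT2 (IH1 i))).
  exists {i : 'I_k & F i}.
  exists (Rel s (fun i => trename (join inl (fun u => inr (existT _ i u))) (t0 i))).
  exists (fun u => g (projT1 u) (projT2 u)) => /=.
  congr Rel; apply: funext => i; apply: etrans (IH' i) _; rewrite trename_comp.
  by congr trename; apply: funext; case.
- have [F1 [u1 [g1 e1]]] := IH1 _ h; have [F2 [u2 [g2 e2]]] := IH2 _ h.
  exists (F1 + F2)%type.
  exists (Imp (rename (join inl (inr \o inl)) u1)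
              (rename (join inl (inr \o inr)) u2)), (join g1 g2) => /=.
  rewrite e1 e2 !rename_comp.
  by congr Imp; congr rename; apply: funext; case.
- pose h' x : option V + W :=
    if x is Some y then (if h y is inl v then inl (Some v)
                         else if h y is inr w then inr w else inl None)
    else inl None.
  have [F [phi0 [g e]]] := IH _ h'.
  pose k (z : option V + F) : option (V + F) :=
    match z with inl o => option_map inl o | inr u => Some (inr u) end.
  exists F, (All (rename k phi0)), g => /=; congr All.
  pose k' (z : option V + W) : option (V + W) :=
    match z with inl o => option_map inl o | inr u => Some (inr u) end.
  transitivity (rename k' (rename h' phi)).
    rewrite rename_comp; congr rename; apply: funext => -[x|//] /=.
    by case: (h x).
  rewrite e !rename_comp; congr rename.
  by apply: funext; case=> [[]|].
Qed.

Lemma finite_support V W (phi : formula L (V + W)) :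
  exists k (phi0 : formula L (V + 'I_k)) (g : 'I_k -> W),
    injective g /\ phi = prename g phi0.
Proof.
have [F [phi0 [g e]]] := finite_support_fintype phi id.
(* Several indices in [F] may name the same parameter; removing duplicates makes the new naming
   injective. *)
pose s : seq {classic W} := undup (codom (g : F -> {classic W})).
have gs u : (g u : {classic W}) \in s by rewrite mem_undup codom_f.
have hs u : (index (g u : {classic W}) s < size s)%N by rewrite index_mem.
exists (size s), (prename (fun u => Ordinal (hs u)) phi0).
exists (tnth (in_tuple s) : 'I_(size s) -> W); split.
  by have /tuple_uniqP : uniq (in_tuple s) by rewrite /= undup_uniq.
rewrite prename_comp -[LHS]rename_id e /prename; congr rename.
apply: funext => -[//|u] /=; congr inr.
by rewrite (tnth_nth (g u : {classic W})) /= nth_index.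
Qed.

Lemma universal_closure k P (phi : formula L ('I_k + P)) :
  exists sigma : formula L P, forall (M : structure L) (c : P -> M),
    sat c sigma <-> forall v : 'I_k -> M, sat (join v c) phi.
Proof.
elim: k phi => [|k IH] phi.
  pose f (z : 'I_0 + P) : P :=
    match z with inl i => match notF (ltn_ord i) with end | inr p => p end.
  exists (rename f phi) => M c; rewrite sat_rename.
  have E (v : 'I_0 -> M) : c \o f = join v c.
    by apply: funext => -[[]|].
  by split=> [h v|h]; [rewrite -E|rewrite (E (c \o f \o inl))].
pose f (z : 'I_k.+1 + P) : option ('I_k + P) :=
  match z with inl i => option_map inl (unlift ord0 i) | inr p => Some (inr p) end.
have [sigma hs] := IH (All (rename f phi)).
exists sigma => M c; rewrite hs; split=> h v; last first.
  move=> a; apply/sat_rename.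
  have := h (fun i => oapp v a (unlift ord0 i)).
  rewrite (_ : join _ _ = oapp (join v c) a \o f) //.
  by apply: funext => -[i|//] /=; case: (unlift ord0 i).
have := h (v \o lift ord0) (v ord0) => /sat_rename.
rewrite (_ : _ \o f = join v c) //; apply: funext => -[i|//] /=.
by case: (unliftP ord0 i) => [j|] ->.
Qed.

Lemma existential_closure k P (phi : formula L ('I_k + P)) :
  exists sigma : formula L P, forall (M : structure L) (c : P -> M),
    sat c sigma <-> exists v : 'I_k -> M, sat (join v c) phi.
Proof.
have [sigma hs] := universal_closure (Neg phi).
exists (Neg sigma) => M c; rewrite sat_neg hs; split=> [h|[v hv] h]; last exact: h hv.
by apply: contrapT => hn; apply: h => v hv; apply: hn; exists v.
Qed.

End Formulas.

(** * Elementary embeddings *)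

Section Elementary.
Variable L : language.

Lemma elementary_sat (M N : structure L) (e : M -> N) V (v : V -> M) phi :
  elementary e -> sat (e \o v) phi <-> sat v phi.
Proof. by move=> /(_ (rename v phi)); rewrite !sat_rename => ->. Qed.

Lemma elementary_id (M : structure L) : elementary (@id M).
Proof. by []. Qed.

Lemma elementary_comp (M N P : structure L) (e : M -> N) (f : N -> P) :
  elementary e -> elementary f -> elementary (f \o e).
Proof.
move=> he hf phi; rewrite (he phi).
exact: iff_sym (elementary_sat e phi hf).
Qed.

Lemma elementary_finterp (M N : structure L) (e : M -> N) k (s : Defs.fsym L k) a :
  elementary e -> e (finterp s a) = finterp s (e \o a).
Proof.
move=> he.
pose phi : formula L (option 'I_k) :=
  Equ (Var L None) (App s (fun i => Var L (Some i))).
have /(_ (erefl _)) := (elementary_sat (oapp a (finterp s a)) phi he).2.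
by rewrite /= => ->.
Qed.

Lemma elementary_rinterp (M N : structure L) (e : M -> N) k (s : rsym L k) a :
  elementary e -> rinterp s a <-> rinterp s (e \o a).
Proof.
move=> he.
exact: iff_sym (elementary_sat a (Rel s (fun i => Var L i)) he).
Qed.

Lemma elementary_inj (M N : structure L) (e : M -> N) :
  elementary e -> injective e.
Proof.
move=> he x y exy.
exact: (elementary_sat (fun b : bool => if b then x else y)
  (Equ (Var L true) (Var L false)) he).1.
Qed.

Lemma elementary_models (M N : structure L) (e : M -> N) T :
  elementary e -> models M T -> models N T.
Proof.
move=> he hM sigma /hM; rewrite -(elementary_sat _ _ he).
by congr sat; apply: funext; case.
Qed.

Lemma elementary_exists (M N : structure L) (e : M -> N) n P (c : P -> M)
    (phi : formula L ('I_n + P)) :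
  elementary e -> (exists v : 'I_n -> N, sat (join v (e \o c)) phi) ->
  exists v : 'I_n -> M, sat (join v c) phi.
Proof.
have [sigma hs] := existential_closure phi.
by move=> he; rewrite -hs elementary_sat // hs.
Qed.

(* Variables are indexed by an arbitrary type [W]; only finitely many of them
   occur in [phi], and they can be quantified out. *)
Lemma elementary_forall (M N : structure L) (e : M -> N) W P (c : P -> M)
    (phi : formula L (W + P)) :
  elementary e -> (forall v : W -> M, sat (join v c) phi) ->
  forall v : W -> N, sat (join v (e \o c)) phi.
Proof.
move=> he hM v.
pose sw A B (z : A + B) : B + A := match z with inl a => inr a | inr b => inl b end.
have [k [phi0 [g [ginj e0]]]] := finite_support (rename (@sw W P) phi).
have hphi (Q : structure L) (w : W -> Q) (d : P -> Q) :
    sat (join w d) phi <-> sat (join (w \o g) d) (rename (@sw P 'I_k) phi0).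
  rewrite sat_rename (_ : _ \o _ = join d (w \o g)); last first.
    by apply: funext; case.
  rewrite -(sat_prename g) -e0 sat_rename (_ : _ \o _ = join w d) //.
  by apply: funext; case.
have [sigma hs] := universal_closure (rename (@sw P 'I_k) phi0).
rewrite hphi; apply: (hs _ _).1; rewrite elementary_sat // hs => u.
(* The tuple [u] has to be extended to all of [W], with [m0] as default value. If [M] is empty, so
   is [N], by the sentence [All Bot], and then [v] shows that [W] is empty. *)
have [[m0]|hM0] := pselect (exists m : M, True); last first.
  have hN : N -> False.
    apply: (elementary_sat (@id M) (All Bot) he).2 => m.
    by case: hM0; exists m.
  have u' : W -> M by move=> w; case: (hN (v w)).
  by rewrite (_ : u = u' \o g) -?hphi //; apply: funext => i; case: hM0; exists (u i).
pose u' w := if pselect (exists i, g i = w) is left h then u (projT1 (cid h)) else m0.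
have := hM u'; rewrite hphi.
rewrite (_ : u' \o g = u) //; apply: funext => i; rewrite /= /u'.
case: pselect => [h|[]]; last by exists i.
by congr u; apply: ginj; case: cid.
Qed.

End Elementary.
(** * Ultrapowers *)

Section Ultrapower.
Variables (L : language) (M : structure L) (J : Type) (W : set_system J).
Hypothesis W_ultra : UltraFilter W.

Definition ucls (f : J -> M) : set (J -> M) := [set g | W [set j | f j = g j]].

(** [Equ] is interpreted by equality in the carrier, so the elements have to be classes of functions
    modulo [W]. *)
Definition upow_carrier := {X : set (J -> M) | exists f, X = ucls f}.

Definition umk (f : J -> M) : upow_carrier := exist _ (ucls f) (ex_intro _ f erefl).

Definition urepr (x : upow_carrier) : J -> M := projT1 (cid (proj2_sig x)).

Lemma umkE f g : umk f = umk g <-> W [set j | f j = g j].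
Proof.
split=> [h|h]; last first.
  apply: eq_exist; apply/seteqP; split=> k hk /=.
    by apply: filterS (filterI h hk) => j [/= <- <-].
  by apply: filterS (filterI h hk) => j [/= -> <-].
have : ucls g g by apply: filterS filterT.
by rewrite (_ : ucls g = ucls f) //; case: h.
Qed.

Lemma ureprK x : umk (urepr x) = x.
Proof.
by rewrite /urepr; case: cid => f e; case: x e => X hX /= e; apply: eq_exist.
Qed.

Definition upow : structure L := @Structure L upow_carrier
  (fun k s ts => umk (fun j => finterp s (fun i => urepr (ts i) j)))
  (fun k s ts => W [set j | rinterp s (fun i => urepr (ts i) j)]).

(** A class determines its representative only [W]-almost everywhere; a finite intersection of sets
    in [W] takes care of all [k] arguments at once. *)
Lemma urepr_umk k (ts : 'I_k -> J -> M) :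
  W [set j | (fun i => urepr (umk (ts i)) j) = (fun i => ts i j)].
Proof.
have h i : W [set j | urepr (umk (ts i)) j = ts i j] by apply/umkE; rewrite ureprK.
by apply: filterS (filter_forall _ h) => j /= hj; apply: funext.
Qed.

Lemma upow_teval V (f : V -> J -> M) t :
  teval (umk \o f : V -> upow) t = umk (fun j => teval (f^~ j) t).
Proof.
elim: t => [x|k s ts IH] //=; apply/umkE.
apply: filterS (urepr_umk (fun i j => teval (f^~ j) (ts i))) => j /= <-.
by congr finterp; apply: funext => i; rewrite IH.
Qed.

Lemma ultra_negP (A : set J) : W (~` A) <-> ~ W A.
Proof.
split=> [hn h|h]; last by have [] := in_ultra_setVsetC A W_ultra.
by apply: (@filter_not_empty _ W); apply: filterS (filterI hn h) => j [].
Qed.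

Lemma Los V (f : V -> J -> M) phi :
  sat (umk \o f : V -> upow) phi <-> W [set j | sat (f^~ j) phi].
Proof.
elim: phi f => [V'|V' t1 t2|V' k s ts|V' phi IH1 psi IH2|V' phi IH] f /=.
- by split=> // /filter_not_empty.
- by rewrite !upow_teval umkE.
- have hW := urepr_umk (fun i j => teval (f^~ j) (ts i)).
  have E j : (fun i => urepr (teval (umk \o f : V' -> upow) (ts i)) j) =
             (fun i => urepr (umk (fun j => teval (f^~ j) (ts i))) j).
    by apply: funext => i; rewrite upow_teval.
  split=> h; apply: filterS (filterI h hW) => j [/= + hj].
    by rewrite E hj.
  by rewrite E hj.
- rewrite IH1 IH2; split=> [h|h h1]; last first.
    by apply: filterS (filterI h h1) => j [/= h' /h'].
  have [h1|/ultra_negP h1] := pselect (W [set j | sat (f^~ j) phi]).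
    by apply: filterS (h h1) => j /= hj _.
  by apply: (filterS _ h1) => j /= hj /hj.
- have E (g : J -> M) : (oapp (umk \o f) (umk g) : _ -> upow) = umk \o oapp f g.
    by apply: funext; case.
  have E' g j : (fun x => oapp f g x j) = oapp (f^~ j) (g j).
    by apply: funext; case.
  split=> [h|h x].
    apply: contrapT => /ultra_negP hn.
    (* At an index with a counterexample, [g] takes one as value. Elsewhere any element will do, and
       there is one because counterexamples exist at some index. *)
    have /choice[g hg] : forall j, exists a : M,
        ~ (forall a : M, sat (oapp (f^~ j) a) phi) -> ~ sat (oapp (f^~ j) a) phi.
      move=> j; have [hj|/existsNP[a ha]] :=
        pselect (forall a : M, sat (oapp (f^~ j) a) phi); last by exists a.
      have [j' [/= /existsNP[a _] _]] := filter_ex (filterI hn hn).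
      by exists a.
    have := h (umk g); rewrite E IH => hW.
    apply: (@filter_not_empty _ W); apply: filterS (filterI hn hW) => j [/= h1 h2].
    by apply: (hg j) => //; rewrite -E'.
  rewrite -[x]ureprK E IH; apply: filterS h => j /= h.
  by rewrite E'.
Qed.

Lemma upow_elementary : elementary (fun x : M => umk (fun=> x) : upow).
Proof.
move=> phi; rewrite (Los (fun x => fun=> x)); split=> h.
  by apply: filterS filterT.
by have [j] := filter_ex h.
Qed.

End Ultrapower.

(** The ultrapower is indexed by the tuples [a] of [M] themselves. The solution sets of the formulas
    of [p] generate a proper filter; along an ultrafilter containing it, the tuple of coordinate
    functions realises [p]. *)
Lemma realise L (M : structure L) V (p : set (formula L (V + M))) :
  complete_type (@id M) p ->
  exists (N : structure L) (e : M -> N) (a : V -> N),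
    elementary e /\ forall phi, p phi <-> sat (join a e) phi.
Proof.
move=> [fs cpl].
have pI phi psi : p phi -> p psi -> p (And phi psi).
  move=> h1 h2; have [//|h3] := cpl (And phi psi).
  have [a ha] := fs [set phi; psi; Neg (And phi psi)] (finite_set3 _ _ _)
    ltac:(by move=> x [[]|] ->).
  have /sat_neg[] := ha _ (or_intror erefl).
  by apply/sat_and; split; apply: ha; left; [left|right].
pose sol phi := [set a : V -> M | sat (join a id) phi].
have sol0 phi : p phi -> sol phi !=set0.
  move=> h; have [a ha] := fs [set phi] (finite_set1 _) ltac:(by move=> x ->).
  by exists a; apply: ha.
have FF : ProperFilter (filter_from p sol).
  apply: filter_from_proper sol0; apply: filter_from_filter.
    have [h|h] := cpl Bot; [by exists Bot|by exists (Neg Bot)].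
  move=> phi psi h1 h2; exists (And phi psi); first exact: pI.
  by move=> a /sat_and.
have [W [WU FW]] := ultraFilterLemma FF.
exists (upow M W), (fun x => umk W (fun=> x)), (fun i => umk W (fun a => a i)).
split; first exact: upow_elementary.
have E phi : sat (join (fun i => umk W (fun a : V -> M => a i))
                       (fun x => umk W (fun=> x)) : _ -> upow M W) phi <-> W (sol phi).
  rewrite (_ : (join _ _ : V + M -> upow M W) =
               umk W \o join (fun i (a : V -> M) => a i) (fun x => fun=> x)); last first.
    by rewrite join_comp.
  rewrite Los (_ : [set _ | _] = sol phi) //; apply/seteqP.
  by split=> a /=; rewrite (_ : (fun _ => _) = join a id) //; apply: funext; case.
move=> phi; rewrite E; split=> [h|h]; first by apply: FW; exists phi.
have [//|h'] := cpl phi.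
have h2 : W (sol (Neg phi)) by apply: FW; exists (Neg phi).
by have [a [? []]] := filter_ex (filterI h h2).
Qed.
(** * Small sets *)

(** By Zorn's lemma there is a maximal partial injection, given by its graph. If it missed a point
    on each side, that pair could be added. *)
Lemma injection_comparable X Y :
  (exists f : X -> Y, injective f) \/ (exists f : Y -> X, injective f).
Proof.
pose P (G : set (X * Y)) := forall u v, G u -> G v -> (u.1 = v.1 <-> u.2 = v.2).
have [|G [PG Gmax]] := @Zorn_bigcup _ P.
  move=> F FP tot u v [G1 F1 u1] [G2 F2 v2].
  have [h|h] := tot _ _ F1 F2; first exact: (FP G2 F2 _ _ (h _ u1) v2).
  exact: (FP G1 F1 _ _ u1 (h _ v2)).
have [hX|/existsNP[x hx]] := pselect (forall x, exists y, G (x, y)).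
  left; have /choice[f hf] := hX; exists f => x x' e.
  exact: (PG _ _ (hf x) (hf x')).2.
have [hY|/existsNP[y hy]] := pselect (forall y, exists x, G (x, y)).
  right; have /choice[f hf] := hY; exists f => y y' e.
  exact: (PG _ _ (hf y) (hf y')).1.
case: (Gmax ((x, y) |` G)).
  split; first by move=> u; right.
  by move=> /(_ (x, y) (or_introl erefl)) h; apply: hx; exists y.
move=> u v [->|Gu] [->|Gv] /=; [by []| | |exact: PG].
  split=> [e|e]; [case: hx; exists v.2|case: hy; exists v.1].
    by rewrite e -surjective_pairing.
  by rewrite e -surjective_pairing.
split=> [e|e]; [case: hx; exists u.2|case: hy; exists u.1].
  by rewrite -e -surjective_pairing.
by rewrite -e -surjective_pairing.
Qed.

Lemma card_le_inj X Y (A : set X) (B : set Y) (f : X -> Y) :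
  (forall x, A x -> B (f x)) ->
  (forall x y, A x -> A y -> f x = f y -> x = y) -> (A #<= B)%card.
Proof.
move=> fun_f inj_f; have /injfunPex[g] :
  exists2 f : X -> Y, set_fun A B f & set_inj A f.
  by exists f => // x y /set_mem Ax /set_mem Ay; apply: inj_f.
exact: inj_card_le.
Qed.

Lemma card_leT_inj X Y (y0 : Y) (A : set X) : (A #<= [set: Y])%card ->
  exists f : X -> Y, forall x y, A x -> A y -> f x = f y -> x = y.
Proof.
move=> /card_leP/injfunPex[g _ inj_g].
exists (fun x => if pselect (A x) is left h then set_val (g (SigSub (mem_set h))) else y0).
move=> x y Ax Ay; case: pselect => // h; case: pselect => // h'.
by move=> /val_inj/inj_g; rewrite !inE => /(_ I I) [].
Qed.

Section Small.
Variables (K : Type) (L : language).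
Hypothesis K_limit : strong_limit K.
Hypothesis K_large : theory_small K L.

Lemma small_le X Y (A : set X) (B : set Y) :
  (A #<= B)%card -> small K B -> small K A.
Proof.
move=> AB [BK KB]; split; first exact: card_le_trans BK.
by move=> KA; apply: KB; apply: card_le_trans AB.
Qed.

Lemma nat_small : small K [set: nat].
Proof.
apply: small_le K_large.
apply: (card_le_inj (f := fun n => Equ (Var L n) (Var L n))) => // m n _ _ [].
by [].
Qed.

Lemma finite_small X (A : set X) : finite_set A -> small K A.
Proof.
move=> /finite_set_countable hA; exact: small_le nat_small.
Qed.

(* [B] embeds in [Y], and [A `|` B] in the power set of the power set of [Y]: an
   element [x] of [B] goes to [{{x}}], an element [x] of [A] outside [B] to
   [{{g x}, set0}]. *)
Let smallU_inj X (A B : set X) (g : A -> B) : injective g ->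
  small K B -> small K (A `|` B).
Proof.
move=> inj_g sB; have [BK _] := sB.
have [k0 _] : exists k : K, True.
  have [kK _] := nat_small; apply: contrapT => nK.
  have /card_leP/injfunPex[f _ _] := kK.
  by apply: nK; exists (set_val (f (SigSub (mem_set (I : [set: nat] 0))))).
have [h inj_h] := card_leT_inj k0 BK.
pose Y := h @` B.
have sY : small K Y by apply: small_le (card_image_le h B) _.
(* [strong_limit] speaks of subsets of [K] only, so the power set of [Y] is brought back into [K] by
   [k] before the hypothesis is applied a second time. *)
have [k inj_k] := card_leT_inj k0 (K_limit sY).1.
pose Y' := k @` [set Z | Z `<=` Y].
have sY' : small K Y' by apply: small_le (card_image_le k _) (K_limit sY).
pose m x : set K := if pselect (B x) then [set k [set h x]]
  else if pselect (A x) is left Ax then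
    [set k [set h (set_val (g (SigSub (mem_set Ax))))]; k set0] else set0.
have hB (b : B) : B (set_val b) by apply: set_mem; apply: valP.
have s1 x : B x -> [set h x] `<=` Y by move=> Bx _ ->; exists x.
have n1 x : B x -> k [set h x] <> k set0.
  move=> Bx /inj_k e; have : set0 (h x) by rewrite -e //; apply: s1.
  by [].
have i1 x y : B x -> B y -> k [set h x] = k [set h y] -> x = y.
  move=> Bx By /inj_k e; apply: inj_h => //.
  have : [set h y] (h x) by rewrite -e //; apply: s1.
  by [].
apply: small_le (K_limit sY'); apply: (card_le_inj (f := m)) => [x ABx|x y].
  rewrite /m /=; case: pselect => [Bx _ ->|nBx]; first by exists [set h x] => //; apply: s1.
  rewrite /=; case: pselect => [Ax _ [->|->]|_ _ []]; last by exists set0 => // y [].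
  by exists [set h (set_val (g (SigSub (mem_set Ax))))] => //; apply: s1.
move=> hx hy; rewrite /m.
case: (pselect (B x)) => [Bx|nBx]; case: (pselect (B y)) => [By|nBy] /=.
- move=> e; apply: i1 => //; suff : [set k [set h y]] (k [set h x]) by [].
  by rewrite -e.
- case: pselect => [Ay|]; last by case: hy.
  move=> e; have : [set k [set h x]] (k set0) by rewrite e; right.
  by move=> /esym/n1; case.
- case: pselect => [Ax|]; last by case: hx.
  move=> e; have : [set k [set h y]] (k set0) by rewrite -e; right.
  by move=> /esym/n1; case.
case: pselect => [Ax|]; last by case: hx.
case: pselect => [Ay|]; last by case: hy.
set gx := g _; set gy := g _ => e.
have : [set k [set h (set_val gy)]; k set0] (k [set h (set_val gx)]).
  by rewrite -e; left.
case=> [/i1 E|/n1]; last by case.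
by have /val_inj/inj_g/(congr1 val) := E (hB _) (hB _).
Qed.

Lemma smallU X (A B : set X) : small K A -> small K B -> small K (A `|` B).
Proof.
move=> sA sB; have [[g /smallU_inj]|[g /smallU_inj]] := injection_comparable A B.
  exact.
by rewrite setUC; apply.
Qed.

End Small.
(** * Uniformly definable relations and definable types *)

Section Extensions.
Variables (L : language) (U : structure L).

Record ext := Ext {
  ext_structure :> structure L;
  emb : U -> ext_structure;
  embP : elementary emb
}.

Arguments emb : clear implicits.
Arguments embP : clear implicits.

Definition ext0 : ext := Ext (@elementary_id L U).

Record ext_hom (I J : ext) (j : I -> J) : Prop := ExtHom {
  ext_hom_elementary : elementary j;
  ext_hom_emb : j \o emb I = emb J
}.

Lemma emb_hom (I : ext) : @ext_hom ext0 I (emb I).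
Proof. by split=> //; apply: embP. Qed.

(** Definability is handled semantically: a relation is given on all elementary extensions of [U] at
    once, and one formula over [A] has to define it everywhere. The closure lemmas below then take
    the place of explicit formulas. *)
Definition dfn (A : set U) V (R : forall I : ext, (V -> I) -> Prop) : Prop :=
  exists phi : formula L (V + A), forall (I : ext) (v : V -> I),
    R I v <-> sat (join v (emb I \o @set_val U A)) phi.

Definition tdfn (A : set U) V (f : forall I : ext, (V -> I) -> I) : Prop :=
  exists t : term L (V + A), forall (I : ext) (v : V -> I),
    f I v = teval (join v (emb I \o @set_val U A)) t.

Section Closure.
Variable A : set U.

Lemma dfn_iff V (R S : forall I : ext, (V -> I) -> Prop) :
  (forall I v, R I v <-> S I v) -> dfn A R -> dfn A S.
Proof. by move=> RS [phi h]; exists phi => I v; rewrite -RS. Qed.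

Lemma dfn_sub V W (f : V -> W) (R : forall I : ext, (V -> I) -> Prop)
    (S : forall I : ext, (W -> I) -> Prop) :
  dfn A R -> (forall I w, S I w <-> R I (w \o f)) -> dfn A S.
Proof.
by move=> [phi h] RS; exists (vrename f phi) => I v; rewrite RS h sat_vrename.
Qed.

Lemma dfn_not V (R : forall I : ext, (V -> I) -> Prop) :
  dfn A R -> dfn A (fun I v => ~ R I v).
Proof. by move=> [phi h]; exists (Neg phi) => I v; rewrite sat_neg h. Qed.

Lemma dfn_and V (R S : forall I : ext, (V -> I) -> Prop) :
  dfn A R -> dfn A S -> dfn A (fun I v => R I v /\ S I v).
Proof.
by move=> [phi h] [psi h']; exists (And phi psi) => I v; rewrite sat_and h h'.
Qed.

Lemma dfn_imp V (R S : forall I : ext, (V -> I) -> Prop) :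
  dfn A R -> dfn A S -> dfn A (fun I v => R I v -> S I v).
Proof.
by move=> [phi h] [psi h']; exists (Imp phi psi) => I v; rewrite /= h h'.
Qed.

Lemma dfn_or V (R S : forall I : ext, (V -> I) -> Prop) :
  dfn A R -> dfn A S -> dfn A (fun I v => R I v \/ S I v).
Proof.
move=> hR hS; apply: dfn_iff (dfn_imp (dfn_not hR) hS) => I v.
by split=> [h|[|] //]; have [?|/h ?] := pselect (R I v); [left|right].
Qed.

Lemma dfn_all V (R : forall I : ext, (V -> I) -> I -> Prop) :
  dfn A (fun I (v : option V -> I) => R I (v \o Some) (v None)) ->
  dfn A (fun I v => forall a, R I v a).
Proof.
move=> [phi h].
pose f (z : option V + A) : option (V + A) :=
  match z with inl o => option_map inl o | inr a => Some (inr a) end.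
exists (All (rename f phi)) => I v /=.
have E a : oapp (join v (emb I \o @set_val U A)) a \o f =
           join (oapp v a) (emb I \o @set_val U A).
  by apply: funext => -[[]|].
split=> hv a.
  by apply/sat_rename; rewrite E -h; exact: hv.
by have /sat_rename := hv a; rewrite E -h.
Qed.

Lemma dfn_ex V (R : forall I : ext, (V -> I) -> I -> Prop) :
  dfn A (fun I (v : option V -> I) => R I (v \o Some) (v None)) ->
  dfn A (fun I v => exists a, R I v a).
Proof.
move=> hR.
apply: dfn_iff (dfn_not (@dfn_all _ (fun I v a => ~ R I v a) (dfn_not hR))).
by move=> I v; split=> [/existsNP[a /contrapT ?]|[a ?] /(_ a)//]; exists a.
Qed.

Lemma dfn_false V : dfn A (fun I (v : V -> I) => False).
Proof. by exists Bot. Qed.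

Lemma tdfn_var V (x : V) : tdfn A (fun I v => v x).
Proof. by exists (Var L (inl x)). Qed.

Lemma dfn_eq V (f g : forall I : ext, (V -> I) -> I) :
  tdfn A f -> tdfn A g -> dfn A (fun I v => f I v = g I v).
Proof. by move=> [s h] [t h']; exists (Equ s t) => I v; rewrite h h'. Qed.

Lemma tdfn_finterp V k (s : Defs.fsym L k) (f : forall I : ext, (V -> I) -> 'I_k -> I) :
  (forall i, tdfn A (fun I v => f I v i)) -> tdfn A (fun I v => finterp s (f I v)).
Proof.
move=> /choice[t h]; exists (App s t) => I v /=.
by congr finterp; apply: funext => i; rewrite h.
Qed.

Lemma dfn_rinterp V k (s : rsym L k) (f : forall I : ext, (V -> I) -> 'I_k -> I) :
  (forall i, tdfn A (fun I v => f I v i)) -> dfn A (fun I v => rinterp s (f I v)).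
Proof.
move=> /choice[t h]; exists (Rel s t) => I v /=.
have -> // : f I v = (fun i => teval (join v (emb I \o @set_val U A)) (t i)).
by apply: funext => i; rewrite h.
Qed.

Lemma dfn_valid V (R : forall I : ext, (V -> I) -> Prop) :
  dfn A R -> (forall v, R ext0 v) -> forall (I : ext) v, R I v.
Proof.
move=> [phi h] hU I v; rewrite h; apply: elementary_forall; first exact: (embP I).
by move=> u; exact: ((h ext0 u).1 (hU u)).
Qed.

Lemma dfn_hom V (R : forall I : ext, (V -> I) -> Prop) (I J : ext) (j : I -> J)
    (v : V -> I) : dfn A R -> ext_hom j -> R I v <-> R J (j \o v).
Proof.
move=> [phi h] [hj ej]; rewrite !h -ej.
by rewrite -(elementary_sat _ phi hj) join_comp compA.
Qed.

End Closure.

Lemma prename_id V P (phi : formula L (V + P)) : prename id phi = phi.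
Proof.
by rewrite -[RHS]rename_id /prename; congr rename; apply: funext; case.
Qed.

Lemma definable_scheme (A : set U) (p : gset U) W
    (psi : formula L ('I_(gdim p) + W)) :
  definable_over A p -> exists chi : formula L (W + A), forall d : W -> U,
    gforms p (prename d psi) <-> sat (join d (@set_val U A)) chi.
Proof.
move=> hp; have [k [psi0 [g [_ ->]]]] := finite_support psi.
have [chi h] := hp _ psi0; exists (vrename g chi) => d.
by rewrite prename_comp h sat_vrename.
Qed.

Lemma definable_sub (A B : set U) p :
  A `<=` B -> definable_over A p -> definable_over B p.
Proof.
move=> AB hp m phi; have [psi h] := hp m phi.
have hB (a : A) : set_val a \in B by apply/mem_set/AB/set_mem/valP.
exists (prename (fun a => SigSub (hB a) : B) psi) => d.
by rewrite h sat_prename.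
Qed.

(* [c] realises in [J] the extension of [p] to [I] given by the definition
   scheme of [p] over [A]. *)
Definition heir (A : set U) (p : gset U) (I J : ext) (j : I -> J)
    (c : 'I_(gdim p) -> J) : Prop :=
  forall W (psi : formula L ('I_(gdim p) + W)) (chi : formula L (W + A)),
    (forall d : W -> U, gforms p (prename d psi) <-> sat (join d (@set_val U A)) chi) ->
    forall w : W -> I,
      sat (join w (emb I \o @set_val U A)) chi <-> sat (join c (j \o w)) psi.

(** The definition scheme of [p], read in [I], yields a set of formulas over [I]. Its completeness
    and finite satisfiability amount to formulas over [A] valid in [U], hence in [I]; [realise] then
    provides [c]. *)
Lemma heir_exists (A : set U) p (I : ext) :
  global_type p -> definable_over A p ->
  exists (J : ext) (j : I -> J) (c : 'I_(gdim p) -> J),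
    ext_hom j /\ heir A j c.
Proof.
move=> [fs cpl] hp.
(* The elements of [I] are the variables of [D psi]; evaluating it at [id] decides whether [psi]
   belongs to the extended type. *)
have /choice[D hD] := fun psi : formula L ('I_(gdim p) + I) => definable_scheme psi hp.
pose pI := [set psi | sat (join id (emb I \o @set_val U A)) (D psi)].
have transfer (theta : formula L (I + A)) :
    (forall d : I -> U, sat (join d (@set_val U A)) theta) ->
    sat (join id (emb I \o @set_val U A)) theta.
  by move=> h; apply: elementary_forall; first exact: (embP I).
have pI_type : complete_type (@id I) pI.
  split=> [F finF FpI|psi]; last first.
    have [?|h] := pselect (pI psi); [by left|right].
    have := transfer (Imp (Neg (D psi)) (D (Neg psi))); apply=> // d /= h'.
    by rewrite -hD; have [/hD|] := cpl (prename d psi).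
  have [theta htheta] := finite_conjunction finF.
  have [sigma hs] := existential_closure theta.
  have [delta hdelta] := finite_conjunction (finite_image D finF).
  have [|a ha] := (hs _ (@id I)).1.
    have := transfer (Imp delta (rename inl sigma)).
    rewrite /= sat_rename; apply=> [d|]; last first.
      by apply/hdelta => _ [psi Fpsi <-]; apply: FpI.
    rewrite sat_rename => /hdelta hd; rewrite (hs _ d).
    have [|a ha] := fs _ (finite_image (prename d) finF).
      by move=> _ [psi Fpsi <-]; apply/hD/hd; exists psi.
    exists a; apply/htheta => psi Fpsi.
    by have := ha _ (ex_intro2 _ _ psi Fpsi erefl); rewrite sat_prename.
  by exists a => psi Fpsi; apply: (htheta _ _).1 ha _ Fpsi.
have [N [e [c [he hc]]]] := realise pI_type.
exists (Ext (elementary_comp (embP I) he)), e, c; split=> // W psi chi h w.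
transitivity (pI (prename w psi)); last by rewrite hc sat_prename.
(* The chosen [D] and the given scheme [chi] define the same set in [U], so they agree in [I]
   too. *)
have T1 := transfer (Imp (D (prename w psi)) (vrename w chi)).
have T2 := transfer (Imp (vrename w chi) (D (prename w psi))).
rewrite /= sat_vrename in T1 T2.
by split; [apply: T2|apply: T1] => d /=; rewrite sat_vrename -h -hD prename_comp.
Qed.

Section Heir.
Variables (A : set U) (p : gset U) (I J : ext) (j : I -> J) (c : 'I_(gdim p) -> J).
Hypotheses (hp : definable_over A p) (hj : ext_hom j) (hc : heir A j c).

Lemma heir_sat phi : gforms p phi <-> sat (join c (emb J)) phi.
Proof.
have [chi h] := definable_scheme phi hp.
have := hc h (emb I); rewrite (ext_hom_emb hj) => <-.
rewrite -[emb I]/(emb I \o id) -compA -join_comp elementary_sat; last exact: embP.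
by rewrite -h prename_id.
Qed.

(** This is the form in which the genericity of [c] over [I] is passed to [core]. The elements of
    [A] in the relation are treated as further parameters of the type, so [chi] meets [A] in two
    places. *)
Lemma heir_dfn Z (R : forall K : ext, ('I_(gdim p) + Z -> K) -> Prop) :
  dfn A R -> exists Q : forall K : ext, (Z -> K) -> Prop,
    dfn A Q /\ forall n : Z -> I, Q I n <-> R J (join c (j \o n)).
Proof.
move=> [rho hR].
pose f (x : 'I_(gdim p) + Z + A) : 'I_(gdim p) + (Z + A) :=
  match x with inl (inl i) => inl i | inl (inr z) => inr (inl z)
             | inr a => inr (inr a) end.
have [chi h] := definable_scheme (rename f rho) hp.
exists (fun K v => sat (join (join v (emb K \o @set_val U A))
                             (emb K \o @set_val U A)) chi).
split=> [|n].
  exists (rename (join id inr) chi) => K v; rewrite sat_rename.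
  by rewrite (_ : _ \o _ = join (join v (emb K \o @set_val U A))
      (emb K \o @set_val U A)) //; apply: funext => -[[]|].
rewrite (hc h) sat_rename hR; apply: iff_trans (iff_refl _) _.
rewrite (_ : _ \o f = join (join c (j \o n)) (emb J \o @set_val U A)) //.
apply: funext => -[[]|] //= a.
by rewrite -(ext_hom_emb hj).
Qed.

End Heir.

Definition gtp (I : ext) n (c : 'I_n -> I) : gset U :=
  @GSet L U n [set phi | sat (join c (emb I)) phi].

Lemma gtp_global (I : ext) n (c : 'I_n -> I) : global_type (gtp c).
Proof.
split=> [F finF Fc|phi]; last by have [] := pselect (sat (join c (emb I)) phi); [left|right].
have [psi h] := finite_conjunction finF.
have [|a ha] := @elementary_exists _ _ _ _ n _ (@id U) psi (embP I).
  by exists c; apply/h.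
by exists a => phi Fphi; apply: (h _ _).1 ha _ Fphi.
Qed.

Lemma global_type_eq p (I : ext) (c : 'I_(gdim p) -> I) :
  (forall phi, gforms p phi <-> sat (join c (emb I)) phi) -> p = gtp c.
Proof.
case: p c => n P c h; congr GSet; apply/seteqP; split=> phi; rewrite /= -/(gforms (GSet P)).
  by move/h.
by move/h.
Qed.

Lemma global_realisation p : global_type p ->
  exists (I : ext) (c : 'I_(gdim p) -> I),
    forall phi, gforms p phi <-> sat (join c (emb I)) phi.
Proof. by move=> /realise[N [e [a [he h]]]]; exists (Ext he), a. Qed.

Lemma realised_gtp (I : ext) n (c : 'I_n -> I) :
  realised (gtp c) <-> exists a : 'I_n -> U, c = emb I \o a.
Proof.
split=> [[a ha]|[a ->]]; last first.
  exists a => phi; rewrite /= -[emb I in X in join _ X]/(emb I \o id) -join_comp.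
  by rewrite elementary_sat //; apply: embP.
exists a; apply: funext => i; apply: contrapT => hi.
have := ha (Neg (Equ (Var L (inl i)) (Var L (inr (a i))))) hi.
exact.
Qed.

End Extensions.

Arguments emb {L U} _ _.
Arguments embP {L U} _ _.
Arguments ext0 {L U}.
(** * Definable sets in o-minimal ordered fields *)

Lemma eventually_finite (X : Type) (T : Type) (le : X -> X -> Prop)
    (P : T -> X -> Prop) (x0 : X) :
  (forall x y z, le x y -> le y z -> le x z) ->
  (forall x y, exists z, le x z /\ le y z) ->
  forall F : set T, finite_set F ->
  (forall J, F J -> exists u, forall u', le u u' -> P J u') ->
  exists u, forall u', le u u' -> forall J, F J -> P J u'.
Proof.
move=> tr dir; apply: finite_set_ind => [_|J F IH h]; first by exists x0.
have [u hu] := h J (or_introl erefl).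
have [J' FJ'|u1 hu1] := IH; first by apply: h; right.
have [z [uz u1z]] := dir u u1.
exists z => u' zu' J' [->|FJ'].
  by apply: hu; apply: tr zu'.
by apply: hu1 => //; apply: tr zu'.
Qed.

Section OrderedField.
Variables (L : language) (O : oring_symbols L).

Definition mzero (M : structure L) : M := finterp (sym0 O) (@app0 M).
Definition mone (M : structure L) : M := finterp (sym1 O) (@app0 M).
Definition madd (M : structure L) (x y : M) : M := finterp (symD O) (app2 x y).
Definition mmul (M : structure L) (x y : M) : M := finterp (symM O) (app2 x y).

(** The content of [real_closed_reduct] as a record, so that [rho] can carry goals about [M] into an
    [rcfType], where [lra] and [nra] apply. *)
Record rcf_model (M : structure L) := RcfModel {
  fld : rcfType;
  rho : M -> fld;
  rho_bij : bijective rho;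
  rho0 : rho (mzero M) = 0%R;
  rho1 : rho (mone M) = 1%R;
  rhoD : forall x y, rho (madd x y) = (rho x + rho y)%R;
  rhoM : forall x y, rho (mmul x y) = (rho x * rho y)%R;
  mltE : forall x y, mlt O x y <-> (rho x < rho y)%R
}.

Lemma rcf_model_exists (M : structure L) :
  real_closed_reduct O M -> exists m : rcf_model M, True.
Proof.
move=> [R [f [bij_f [[f0 f1 _ fD fM] flt]]]].
by exists (@RcfModel M R f bij_f f0 f1 fD fM flt).
Qed.

Section Model.
Variables (M : structure L) (m : rcf_model M).
Local Open Scope ring_scope.
Local Notation rho := (rho m).

Lemma rho_inj : injective rho.
Proof. exact: bij_inj (rho_bij m). Qed.

Lemma rho_surj r : exists x, rho x = r.
Proof. by have [g _ gK] := rho_bij m; exists (g r); apply: gK. Qed.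

Lemma nmltE x y : ~ mlt O x y <-> rho y <= rho x.
Proof. by rewrite (mltE m) leNgt; split=> /negP. Qed.

Definition rhoE := (rho0 m, rho1 m, rhoD m, rhoM m).

Hypothesis M_omin : ominimal O M.

Definition convex (S : set M) : Prop :=
  forall x y z, S x -> S y -> mlt O x z -> mlt O z y -> S z.

Definition is_sup (S : set M) (s : M) : Prop :=
  (forall x, S x -> ~ mlt O s x) /\ forall b, mlt O b s -> exists2 x, S x & mlt O b x.

Definition msection (S : set M) : Prop :=
  exists phi : formula L ('I_1 + M), forall x, S x <-> sat (join (app1 x) id) phi.

Let ominimal_section (S : set M) : msection S -> exists F : set (set M),
  [/\ finite_set F,
      forall J, F J -> (exists a, J = [set a]) \/
                       (exists lo hi, J = open_interval O lo hi) &
      S = \bigcup_(J in F) J].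
Proof.
move=> [phi h]; have [F [finF hF e]] := M_omin phi; exists F; split=> //.
by rewrite -e; apply/seteqP; split=> x /h.
Qed.

Lemma finite_convex_cover S : msection S -> exists F : set (set M),
  [/\ finite_set F, forall J, F J -> convex J & S = \bigcup_(J in F) J].
Proof.
move=> /ominimal_section[F [finF hF e]]; exists F; split=> // J /hF[[a ->]|[lo [hi ->]]].
  move=> x y z -> ->; rewrite !(mltE m) => h1 h2.
  by have := lt_trans h1 h2; rewrite ltxx.
move=> x y z [x1 x2] [y1 y2] /(mltE m) xz /(mltE m) zy; split.
  by case: lo x1 {y1} => // a /(mltE m) ax; apply/(mltE m); apply: lt_trans xz.
by case: hi y2 {x2} => // a /(mltE m) ya; apply/(mltE m); apply: lt_trans ya.
Qed.

Lemma mdense (x y : M) : rho x < rho y -> exists z, rho x < rho z < rho y.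
Proof.
move=> xy; have [z hz] := rho_surj ((rho x + rho y) / 2%:R); exists z.
by rewrite hz !midf_lt.
Qed.

Lemma mabove (x : M) : exists z, rho x < rho z.
Proof.
by have [z hz] := rho_surj (rho x + 1); exists z; rewrite hz ltrDl.
Qed.

(** The alternatives are: empty, unbounded above, having a supremum. Their disjunction passes to
    finite unions, so o-minimality reduces [sup_exists] to points and intervals. *)
Let has_sup (S : set M) : Prop :=
  (forall x, ~ S x) \/ (forall b, exists2 x, S x & mlt O b x) \/ exists s, is_sup S s.

Let has_supU S S' : has_sup S -> has_sup S' -> has_sup (S `|` S').
Proof.
move=> [h|[h _|[s [s1 s2]]]]; first by rewrite (_ : S `|` S' = S') //;
  apply/seteqP; split=> x; [case=> // /h|right].
  by right; left=> b; have [x Sx bx] := h b; exists x => //; left.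
move=> [h'|[h'|[s' [s1' s2']]]]; right.
- right; exists s; rewrite (_ : S `|` S' = S) //.
  by apply/seteqP; split=> x; [case=> // /h'|left].
- by left=> b; have [x Sx bx] := h' b; exists x => //; right.
right; have [ss'|s's] := leP (rho s) (rho s').
  exists s'; split=> [x [/s1|/s1'//]|b /s2'[x]].
    by rewrite !nmltE => /le_trans; apply.
  by exists x => //; right.
exists s; split=> [x [/s1//|/s1']|b /s2[x]].
  by rewrite !nmltE => /le_trans; apply; apply: ltW.
by exists x => //; left.
Qed.

Let has_sup1 a : has_sup [set a].
Proof.
right; right; exists a; split=> [x ->|b ba]; last by exists a.
by rewrite nmltE.
Qed.

Let has_sup_interval lo hi : has_sup (open_interval O lo hi).
Proof.
have [[x [xlo xhi]]|h] := pselect (exists x, open_interval O lo hi x); last first.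
  by left=> x hx; apply: h; exists x.
right; case: hi xhi => [c /(mltE m) xc|_].
  right; exists c; split=> [y [_]|b /(mltE m) bc].
    by rewrite nmltE (mltE m) => /ltW.
  (* The interval contains [x], hence every point between [x] and [c]; [y] is taken above [b] as
     well. *)
  have [y [hy bxy]] : exists y, rho y < rho c /\ (rho b < rho y /\ rho x < rho y).
    have [bx|xb] := leP (rho b) (rho x).
      have [y /andP[h1 h2]] := mdense xc; exists y; split=> //; split=> //.
      exact: le_lt_trans h1.
    have [y /andP[h1 h2]] := mdense bc; exists y; split=> //; split=> //.
    exact: lt_trans h1.
  exists y; last by apply/(mltE m); case: bxy.
  split; last exact/(mltE m).
  case: lo xlo => // a /(mltE m) ax; apply/(mltE m); apply: lt_trans ax _.
  by case: bxy.
left=> b; have [y [hb hx]] : exists y, rho b < rho y /\ rho x < rho y.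
  have [bx|xb] := leP (rho b) (rho x).
    by have [y h1] := mabove x; exists y; split=> //; apply: le_lt_trans h1.
  by have [y h1] := mabove b; exists y; split=> //; apply: lt_trans h1.
exists y; last exact/(mltE m).
split=> //; case: lo xlo => // a /(mltE m) ax; apply/(mltE m).
exact: lt_trans hx.
Qed.

Lemma sup_exists S : msection S -> (exists x, S x) ->
  (exists b, forall x, S x -> ~ mlt O b x) -> exists s, is_sup S s.
Proof.
move=> /ominimal_section[F [finF hF ->]].
have main : has_sup (\bigcup_(J in F) J).
  move: F finF hF; apply: finite_set_ind => [_|J F IH hF].
    by left=> x [].
  rewrite bigcup_setU1; apply: has_supU; last by apply: IH => J' FJ'; apply: hF; right.
  have [[a ->]|[lo [hi ->]]] := hF J (or_introl erefl); first exact: has_sup1.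
  exact: has_sup_interval.
move=> [x Sx] [b hb]; have [|[|//]] := main; first by move=> /(_ x).
by move=> /(_ b)[y /hb].
Qed.

Let eventually_constant_interval lo hi : exists u,
  (forall x, rho u < rho x -> open_interval O lo hi x) \/
  (forall x, rho u < rho x -> ~ open_interval O lo hi x).
Proof.
case: hi => [b|].
  by exists b; right=> x bx [_ /(mltE m) xb]; have := lt_trans bx xb; rewrite ltxx.
case: lo => [a|]; last by exists (mzero M); left.
by exists a; left=> x ax; split=> //; apply/(mltE m).
Qed.

(** A point or an interval bounded above misses all large elements, and an interval unbounded above
    contains them. This makes the type at infinity in [nonrealised_definable_exists] complete. *)
Lemma eventually_constant S : msection S -> exists u,
  (forall x, mlt O u x -> S x) \/ (forall x, mlt O u x -> ~ S x).
Proof.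
move=> /ominimal_section[F [finF hF ->]].
suff [u hu] : exists u, (forall x, rho u < rho x -> (\bigcup_(J in F) J) x) \/
                       (forall x, rho u < rho x -> ~ (\bigcup_(J in F) J) x).
  exists u; case: hu => h; [left|right]; by move=> x /(mltE m); apply: h.
move: F finF hF; apply: finite_set_ind => [_|J F IH hF].
  by exists (mzero M); right=> x _ [].
have [u1 h1] : exists u, (forall x, rho u < rho x -> J x) \/
                         (forall x, rho u < rho x -> ~ J x).
  have [[a ->]|[lo [hi ->]]] := hF J (or_introl erefl); last exact: eventually_constant_interval.
  by exists a; right=> x ax e; move: ax; rewrite e ltxx.
have [|u2 h2] := IH; first by move=> J' FJ'; apply: hF; right.
have [u [u1u u2u]] : exists u, rho u1 <= rho u /\ rho u2 <= rho u.
  by have [h|/ltW h] := leP (rho u1) (rho u2); [exists u2|exists u1].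
rewrite bigcup_setU1; exists u.
case: h1 => h1; first by left=> x ux; left; apply: h1; apply: le_lt_trans ux.
case: h2 => h2; first by left=> x ux; right; apply: h2; apply: le_lt_trans ux.
by right=> x ux [/h1|/h2]; apply; apply: le_lt_trans ux.
Qed.

End Model.
End OrderedField.
(** * Approximating externally definable sets *)

Section Approximation.
Variables (L : language) (O : oring_symbols L) (U : structure L).
Local Notation ext := (ext U).
Local Notation zero := (mzero O _).
Local Notation one := (mone O _).
Local Notation "x <' y" := (mlt O x y) (at level 70).
Local Notation "x +' y" := (madd O x y) (at level 50, left associativity).
Local Notation "x *' y" := (mmul O x y) (at level 40, left associativity).

Lemma app2_comp (M N : Type) (h : M -> N) x y : h \o app2 x y = app2 (h x) (h y).
Proof. by apply: funext => i; rewrite /app2 /=; case: ifP. Qed.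

Section Hom.
Variables (I J : ext) (j : I -> J).
Hypothesis hj : ext_hom j.
Let ej := ext_hom_elementary hj.

Lemma hom0 : j zero = zero.
Proof.
rewrite /mzero (elementary_finterp _ _ ej); congr finterp.
by apply: funext => -[].
Qed.

Lemma hom1 : j one = one.
Proof.
rewrite /mone (elementary_finterp _ _ ej); congr finterp.
by apply: funext => -[].
Qed.

Lemma homD x y : j (x +' y) = j x +' j y.
Proof. by rewrite /madd (elementary_finterp _ _ ej) app2_comp. Qed.

Lemma homM x y : j (x *' y) = j x *' j y.
Proof. by rewrite /mmul (elementary_finterp _ _ ej) app2_comp. Qed.

Lemma hom_lt x y : j x <' j y <-> x <' y.
Proof. by rewrite /mlt (elementary_rinterp _ _ ej) app2_comp. Qed.

End Hom.

Section Closure.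
Variable A : set U.

Lemma tdfn0 V : tdfn A (fun (I : ext) (v : V -> I) => zero).
Proof. by apply: tdfn_finterp => -[]. Qed.

Lemma tdfn1 V : tdfn A (fun (I : ext) (v : V -> I) => one).
Proof. by apply: tdfn_finterp => -[]. Qed.

Lemma tdfnD V (f g : forall I : ext, (V -> I) -> I) : tdfn A f -> tdfn A g ->
  tdfn A (fun I v => f I v +' g I v).
Proof. by move=> hf hg; apply: tdfn_finterp => i; rewrite /app2; case: (i == ord0). Qed.

Lemma tdfnM V (f g : forall I : ext, (V -> I) -> I) : tdfn A f -> tdfn A g ->
  tdfn A (fun I v => f I v *' g I v).
Proof. by move=> hf hg; apply: tdfn_finterp => i; rewrite /app2; case: (i == ord0). Qed.

Lemma dfn_lt V (f g : forall I : ext, (V -> I) -> I) : tdfn A f -> tdfn A g ->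
  dfn A (fun I v => f I v <' g I v).
Proof. by move=> hf hg; apply: dfn_rinterp => i; rewrite /app2; case: (i == ord0). Qed.

(** The arguments of relations are assembled with [join], [oapp] and compositions; [f] names the
    underlying renaming of variables, which is then checked one variable at a time. *)
Lemma dfn_app V W (R : forall I : ext, (V -> I) -> Prop)
    (g : forall I : ext, (W -> I) -> V -> I) (f : V -> W) :
  dfn A R -> (forall I w x, g I w x = w (f x)) -> dfn A (fun I w => R I (g I w)).
Proof.
move=> hR hg; apply: (dfn_sub (f := f) hR) => I w.
by rewrite (_ : g I w = w \o f) //; apply: funext => x; rewrite hg.
Qed.

Lemma dfn_msection V (R : forall I : ext, (V -> I) -> I -> Prop) (I : ext) (v : V -> I) :
  dfn A (fun I (v : option V -> I) => R I (v \o Some) (v None)) ->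
  msection [set x | R I v x].
Proof.
move=> [phi h].
pose f (z : option V + A) : 'I_1 + I :=
  match z with inl (Some x) => inr (v x) | inl None => inl ord0
             | inr a => inr (emb I (set_val a)) end.
exists (rename f phi) => x; rewrite sat_rename.
rewrite (_ : _ \o f = join (oapp v x) (emb I \o @set_val U A)); last first.
  by apply: funext => -[[]|].
exact: h (oapp v x).
Qed.

End Closure.

(* [w] differs from [g] by less than [1 / t], for positive [t]. *)
Definition close (M : structure L) (t g w : M) : Prop :=
  w <> g /\ (w *' t <' one +' g *' t /\ g *' t <' one +' w *' t).

Lemma closeE (M : structure L) (m : rcf_model O M) (t g w : M) :
  close t g w <-> (rho m w <> rho m g /\
    (rho m w * rho m t < 1 + rho m g * rho m t /\
     rho m g * rho m t < 1 + rho m w * rho m t))%R.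
Proof.
rewrite /close !(mltE m) !rhoE; split=> -[h1 h2]; split=> // e; apply: h1.
  exact: rho_inj e.
by rewrite e.
Qed.

Lemma dfn_close (A : set U) V (f g h : forall I : ext, (V -> I) -> I) :
  tdfn A f -> tdfn A g -> tdfn A h -> dfn A (fun I v => close (f I v) (g I v) (h I v)).
Proof.
move=> hf hg hh.
by do ?[apply: dfn_and|apply: dfn_not|apply: dfn_eq|apply: dfn_lt|apply: tdfnD|
  apply: tdfnM|apply: tdfn1].
Qed.

Hypothesis model : forall I : ext, rcf_model O I.
Hypothesis omin : forall I : ext, ominimal O I.
Local Notation rho I := (rho (model I)).

Lemma close_mono (I : ext) (t t' g w : I) :
  zero <' t -> ~ t' <' t -> close t' g w -> close t g w.
Proof.
rewrite (nmltE (model I)) (mltE (model I)) !(closeE (model I)) rhoE.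
move: (rho I t) (rho I t') (rho I g) (rho I w) => a b x y a0 ab [h1 [h2 h3]]; split=> //; split.
  by have [xy|yx] := leP x y; nra.
by have [xy|yx] := leP x y; nra.
Qed.

(** Definability over [A] of the type of [s] over [U], phrased with [dfn] and for any index type, so
    that [s] may also be a pair of tuples. *)
Definition definable_tuple (A : set U) (I : ext) X (s : X -> I) : Prop :=
  forall Z (R : forall K : ext, (X + Z -> K) -> Prop), dfn A R ->
  exists Q : forall K : ext, (Z -> K) -> Prop,
    dfn A Q /\ forall d : Z -> U, Q ext0 d <-> R I (join s (emb I \o d)).

(** * Limit points of an externally definable set *)

Section Near.
Variables (A : set U) (I : ext) (X Z : Type) (s : X -> I).
Variable R : forall K : ext, (X + option Z -> K) -> Prop.
Hypothesis hs : definable_tuple A s.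
Hypothesis dfn_R : dfn A R.

(** With arguments [z], [t], [g] packed as [oapp (oapp z t) g], this expresses inside [U] that [R]
    has a solution other than [g] within [1 / t] of [g]. Definability of the type of [s] provides
    it. *)
Variable G0 : forall K : ext, (option (option Z) -> K) -> Prop.
Hypothesis dfn_G0 : dfn A G0.
Hypothesis G0E : forall d : option (option Z) -> U, G0 (K := ext0) d <->
  exists w, R (K := I) (join s (oapp (emb I \o d \o Some \o Some) w)) /\
            close (emb I (d (Some None))) (emb I (d None)) w.

Definition limit_point (K : ext) (z : Z -> K) (g : K) : Prop :=
  forall t, zero <' t -> G0 (K := K) (oapp (oapp z t) g).

(** The three cases are neighbourhoods of the two infinite ends and punctured neighbourhoods of the
    limit points, all shrinking as [t] grows. The puncture prevents a limit point in [U] from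
    staying near itself at every level. *)
Definition near (K : ext) (z : Z -> K) (t w : K) : Prop :=
  t <' w \/ w +' t <' zero \/ exists g, limit_point z g /\ close t g w.

Lemma dfn_limit_point :
  dfn A (fun K (v : option Z -> K) => limit_point (v \o Some) (v None)).
Proof.
apply: dfn_all; apply: dfn_imp; first by apply: dfn_lt; [exact: tdfn0|exact: tdfn_var].
apply: (dfn_app (f := fun x => if x is Some (Some z) then Some (Some z)
                       else if x is Some None then None else Some None) dfn_G0).
by move=> K w [[]|].
Qed.

Lemma dfn_near : dfn A (fun K (v : option (option Z) -> K) =>
  near (v \o Some \o Some) (v (Some None)) (v None)).
Proof.
apply: dfn_or; first by apply: dfn_lt; exact: tdfn_var.
apply: dfn_or.
  by apply: dfn_lt; [apply: tdfnD; exact: tdfn_var|exact: tdfn0].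
apply: dfn_ex; apply: dfn_and; last by apply: dfn_close; exact: tdfn_var.
apply: (dfn_sub (f := fun x => if x is Some z then Some (Some (Some z)) else None)
  dfn_limit_point) => K w.
by [].
Qed.

Lemma near_mono (K : ext) (z : Z -> K) t t' w :
  zero <' t -> ~ t' <' t -> near z t' w -> near z t w.
Proof.
move=> t0 tt' [h|[h|[g [hg h]]]].
- left; move: tt' h; rewrite (nmltE (model K)) !(mltE (model K)).
  exact: le_lt_trans.
- right; left; move: tt' h; rewrite (nmltE (model K)) !(mltE (model K)) !rhoE; lra.
by right; right; exists g; split=> //; apply: close_mono h.
Qed.

Variable d : Z -> U.
Let Y : set I := [set w | R (K := I) (join s (oapp (emb I \o d) w))].
Hypothesis Y_nonstandard : forall u : U, ~ Y (emb I u).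

Let Y_section : msection Y.
Proof.
pose R' (K : ext) (v : X + Z -> K) (w : K) :=
  R (K := K) (join (v \o inl) (oapp (v \o inr) w)).
apply: (@dfn_msection A _ R' I (join s (emb I \o d))).
apply: (dfn_app (f := fun x : X + option Z => match x with inl x => Some (inl x)
  | inr (Some z) => Some (inr z) | inr None => None end) dfn_R).
by move=> K w [x|[z|]].
Qed.

Local Notation rhoU := (rho ext0).
Local Notation iota u := (rho I (emb I u)).

Let surjU r : exists u : U, rhoU u = r.
Proof. exact: rho_surj. Qed.

Let iota_lt u v : (iota u < iota v <-> rhoU u < rhoU v)%R.
Proof. by rewrite -!mltE (hom_lt (emb_hom I)). Qed.

Let iota_eqD a b c : (rhoU a + rhoU b = rhoU c -> iota a + iota b = iota c)%R.
Proof.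
rewrite -rhoD => /rho_inj <-.
by rewrite (homD (emb_hom I)) rhoD.
Qed.

Let iota_eqM a b c : (rhoU a * rhoU b = rhoU c -> iota a * iota b = iota c)%R.
Proof.
rewrite -rhoM => /rho_inj <-.
by rewrite (homM (emb_hom I)) rhoM.
Qed.

Let iota0 u : (rhoU u = 0 -> iota u = 0)%R.
Proof. by rewrite -(rho0 (model ext0)) => /rho_inj->; rewrite (hom0 (emb_hom I)) rho0. Qed.

Let iota1 u : (rhoU u = 1 -> iota u = 1)%R.
Proof. by rewrite -(rho1 (model ext0)) => /rho_inj->; rewrite (hom1 (emb_hom I)) rho1. Qed.

Let adherent (J : set I) (g : U) : Prop :=
  forall t : U, zero <' t -> exists2 w, J w & close (emb I t) (emb I g) w.

Let iota_close t g w : (close (emb I t) (emb I g) w <->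
  rho I w <> iota g /\ rho I w * iota t < 1 + iota g * iota t /\
  iota g * iota t < 1 + rho I w * iota t)%R.
Proof. exact: closeE. Qed.

(* Two adherent points are separated by their midpoint, which [J] would contain. *)
Let adherent_lt (J : set I) g g' : convex O J -> J `<=` Y ->
  adherent J g -> adherent J g' -> ~ (rhoU g < rhoU g')%R.
Proof.
move=> cJ JY hg hg' gg'.
(* At this level the radius [1 / t] is half the distance from [g] to [g'], so [w] and [w'] lie on
   different sides of the midpoint [m]. *)
have [t tE] := surjU (2 / (rhoU g' - rhoU g))%R.
have [m mE] := surjU ((rhoU g' + rhoU g) / 2)%R.
(* Only equations between elements of [U] are carried over by [iota_eqD] and [iota_eqM], so every
   intermediate quantity gets a name in [U]. *)
have [k kE] := surjU (rhoU g' - rhoU g)%R.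
have [l lE] := surjU 1%R.
have [z zE] := surjU 0%R.
have [l2 l2E] := surjU 2%R.
have [s2 s2E] := surjU (rhoU g' + rhoU g)%R.
have d0 : (0 < rhoU g' - rhoU g)%R by rewrite subr_gt0.
have t0 : (0 < rhoU t)%R by rewrite tE divr_gt0.
have [w Jw /iota_close[_ [w1 _]]] : exists2 w, J w & close (emb I t) (emb I g) w.
  by apply: hg; rewrite (mltE (model ext0)) rhoE.
have [w' Jw' /iota_close[_ [_ w2]]] : exists2 w, J w & close (emb I t) (emb I g') w.
  by apply: hg'; rewrite (mltE (model ext0)) rhoE.
have i0 := iota0 zE; have i1 := iota1 lE.
have e1 : (iota g + iota k = iota g')%R by apply: iota_eqD; rewrite kE; lra.
have e2 : (iota l + iota l = iota l2)%R by apply: iota_eqD; rewrite lE l2E; lra.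
have e3 : (iota t * iota k = iota l2)%R.
  by apply: iota_eqM; rewrite tE kE l2E divfK ?gt_eqF.
have e4 : (iota g' + iota g = iota s2)%R by apply: iota_eqD; rewrite s2E.
have e5 : (iota m + iota m = iota s2)%R by apply: iota_eqD; rewrite mE s2E; lra.
have it0 : (0 < iota t)%R by rewrite -i0 iota_lt zE.
apply: (@Y_nonstandard m); apply: JY; apply: (cJ _ _ _ Jw Jw');
  rewrite (mltE (model I)) -(ltr_pM2r it0); nra.
Qed.

Let adherent_unique (J : set I) g g' : convex O J -> J `<=` Y ->
  adherent J g -> adherent J g' -> g = g'.
Proof.
move=> cJ JY hg hg'; apply: (@rho_inj _ _ _ (model ext0)); apply/le_anti/andP.
split; rewrite leNgt; apply/negP; first exact: adherent_lt cJ JY hg' hg.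
exact: adherent_lt cJ JY hg hg'.
Qed.

Let leU (x y : U) : Prop := (rhoU x <= rhoU y)%R.

Let leU_trans x y z : leU x y -> leU y z -> leU x z.
Proof. exact: le_trans. Qed.

Let leU_dir x y : exists z, leU x z /\ leU y z.
Proof. by rewrite /leU; have [h|/ltW h] := leP (rhoU x) (rhoU y); [exists y|exists x]. Qed.

Let posU (x : U) : mlt O (mzero O ext0) x <-> (0 < rhoU x)%R.
Proof. by rewrite (mltE (model ext0)) rhoE. Qed.

(* Each of the finitely many convex components of [Y] is adherent to at most one
   standard point, so the standard points adherent to [Y] are isolated. *)
Lemma near_exit (w : U) : exists u : U, zero <' u /\ ~ near (K := ext0) d u w.
Proof.
have [F [finF cF YE]] := finite_convex_cover (model I) (@omin I) Y_section.
have FY J : F J -> J `<=` Y by move=> FJ x Jx; rewrite YE; exists J.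
have [u0 hu0] : exists u, forall u', leU u u' -> forall J, F J ->
    (0 < rhoU u')%R -> forall g, adherent J g -> ~ close (M := ext0) u' g w.
  apply: (eventually_finite w leU_trans leU_dir finF) => J FJ.
  (* [J] has at most one adherent point. If it is [w], the puncture in [close] excludes it; if it is
     some other [g], the levels from [1 / |w - g|] on do. *)
  have [[g [hg gw]]|hn] := pselect (exists g, adherent J g /\ w <> g); last first.
    exists w => u' _ _ g hg [wg _]; apply: hn; by exists g.
  have [u uE] := surjU (`|rhoU w - rhoU g|^-1)%R.
  exists u => u' uu' u'0 g' hg'; rewrite -(adherent_unique (cF _ FJ) (FY _ FJ) hg hg').
  move=> /(closeE (model ext0)) [_ [h1 h2]].
  have wg : (0 < `|rhoU w - rhoU g|)%R.
    by rewrite normr_gt0 subr_eq0; apply/eqP => /(@rho_inj _ _ _ (model ext0)).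
  have : (1 <= rhoU u' * `|rhoU w - rhoU g|)%R.
    by rewrite -ler_pdivrMr // mul1r -uE.
  have [xy|/ltW yx] := leP 0%R (rhoU w - rhoU g)%R.
    by rewrite ger0_norm //; clear YE; nra.
  by rewrite ler0_norm //; clear YE; nra.
(* This level is positive, beyond [u0], and larger than [|w|], which keeps [w] away from both
   infinite ends. *)
have [u uE] := surjU (`|rhoU u0| + `|rhoU w| + 1)%R.
have h0 := ler_norm (rhoU u0); have h1 := ler_norm (rhoU w).
have h2 := ler_norm (- rhoU w)%R; rewrite normrN in h2.
have h3 := normr_ge0 (rhoU u0); have h4 := normr_ge0 (rhoU w).
have u0' : (0 < rhoU u)%R by rewrite uE; clear YE; lra.
exists u; split; first exact/posU.
case=> [|[|[g [hg]]]].
- by rewrite (mltE (model ext0)) uE => h; clear YE; lra.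
- by rewrite (mltE (model ext0)) !rhoE uE => h; clear YE; lra.
(* A limit point is adherent to a single component: otherwise each of the finitely many components
   would avoid it from some level on, and [Y] would avoid it at a common level. *)
suff [J FJ hJ] : exists2 J, F J & adherent J g.
  by apply: hu0 hJ => //; rewrite /leU uE; clear YE; lra.
apply: contrapT => hn.
have [t ht] : exists t, forall t', leU t t' -> forall J, F J ->
    (0 < rhoU t')%R -> forall v, J v -> ~ close (emb I t') (emb I g) v.
  apply: (eventually_finite w leU_trans leU_dir finF) => J FJ.
  have [t [t0 htn]] : exists t, zero <' t /\
      forall v, J v -> ~ close (emb I t) (emb I g) v.
    apply: contrapT => hn'; apply: hn; exists J => // t t0.
    apply: contrapT => hn''; apply: hn'; exists t; split=> // v Jv hv.
    by apply: hn''; exists v.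
  exists t => t' tt' t'0 v Jv hv; apply: (htn v Jv).
  apply: close_mono hv; first by rewrite -(hom0 (emb_hom I)) (hom_lt (emb_hom I)).
  by rewrite (hom_lt (emb_hom I)) (nmltE (model ext0)).
have [t' t'E] := surjU (`|rhoU t| + 1)%R.
have t'0 : (0 < rhoU t')%R.
  by rewrite t'E; have := normr_ge0 (rhoU t); clear YE; lra.
have [v [Yv hv]] := (G0E _).1 (hg t' ((posU _).2 t'0)).
have : Y v by [].
rewrite YE => -[J FJ Jv]; apply: (ht t') FJ _ _ Jv hv => //.
by rewrite /leU t'E; have := ler_norm (rhoU t); clear YE; lra.
Qed.

(** The part [S] of [Y] outside the neighbourhoods lies between [- u] and [u]. If it is nonempty,
    the cut [C] of [U] below it has a supremum [g] in [U], to which [S] is adherent. So [g] is a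
    limit point of [Y], and [S] meets its neighbourhood, a contradiction. *)
Lemma near_cover (u : U) (w : I) : zero <' u -> Y w -> near (emb I \o d) (emb I u) w.
Proof.
move=> u0 Yw; apply: contrapT => nw.
pose S := [set w | Y w /\ ~ near (emb I \o d) (emb I u) w].
(* [RC] says that its last argument lies below all of [S]. Since the type of [s] is definable, this
   makes [C] definable in [U], where o-minimality gives it a supremum. *)
pose RC (K : ext) (v : X + option (option Z) -> K) := forall w : K,
  R (join (v \o inl) (oapp (v \o inr \o Some \o Some) w)) ->
  ~ near (v \o inr \o Some \o Some) (v (inr (Some None))) w -> v (inr None) <' w.
have dfn_RC : dfn A RC.
  apply: dfn_all; apply: dfn_imp; [|apply: dfn_imp].
  - apply: (dfn_app (f := fun x : X + option Z => match x with inl x => Some (inl x)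
      | inr (Some z) => Some (inr (Some (Some z))) | inr None => None end) dfn_R).
    by move=> K v [x|[z|]].
  - apply: dfn_not; apply: (dfn_sub (f := fun x : option (option Z) => match x with
      | Some (Some z) => Some (inr (Some (Some z)))
      | Some None => Some (inr (Some None)) | None => None end) dfn_near) => K v.
    by [].
  by apply: dfn_lt; exact: tdfn_var.
have [QC [dfn_QC hQC]] := hs dfn_RC.
pose C := [set v : U | QC ext0 (oapp (oapp d u) v)].
have CE v : C v <-> forall w, S w -> emb I v <' w.
  by rewrite /C /= hQC /RC; split=> h w'; [case; exact: h|move=> h1 h2; exact: h].
have C_section : @msection L ext0 C.
  apply: (@dfn_msection A _ (fun K z x => QC K (oapp z x)) ext0 (oapp d u)).
  by apply: (dfn_app (f := fun x => x) dfn_QC) => K v [x|].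
have S_bound v : S v -> (rho I v <= iota u /\ - iota u <= rho I v)%R.
  move=> [_ hv]; split; rewrite leNgt; apply/negP => h; apply: hv.
    by left; rewrite (mltE (model I)).
  by right; left; rewrite (mltE (model I)) !rhoE; lra.
have [g [g1 g2]] : exists g, is_sup O C g.
  apply: (sup_exists (model ext0) (@omin ext0) C_section).
    have [v vE] := surjU (- rhoU u - 1)%R.
    have [z zE] := surjU 0%R.
    have [l lE] := surjU 1%R.
    have [a aE] := surjU (- 1)%R.
    exists v; apply/CE => w' /S_bound[_ h]; rewrite (mltE (model I)).
    have e1 : (iota u + iota v = iota a)%R by apply: iota_eqD; rewrite vE aE; lra.
    have e2 : (iota l + iota a = iota z)%R by apply: iota_eqD; rewrite lE aE zE; lra.
    by have i0 := iota0 zE; have i1 := iota1 lE; lra.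
  exists u => v /CE /(_ w (conj Yw nw)); rewrite (mltE (model I)) => h.
  rewrite (nmltE (model ext0)) leNgt; apply/negP; rewrite -iota_lt => h'.
  by have [h3 _] := S_bound w (conj Yw nw); lra.
have close_g t : zero <' t -> exists2 v, S v & close (emb I t) (emb I g) v.
  move=> /posU t0.
  (* As [b = g + e] is not in [C] while some element of [C] exceeds [a = g - e], a point of [S] lies
     within [e] of [g]. The bound on one side is not strict, whence [e = 1 / (2 t)] instead of
     [1 / t]. *)
  have [e eE] := surjU ((2 * rhoU t)^-1)%R.
  have [b bE] := surjU (rhoU g + (2 * rhoU t)^-1)%R.
  have [a aE] := surjU (rhoU g - (2 * rhoU t)^-1)%R.
  have [l lE] := surjU 1%R.
  have [h hE] := surjU (1 / 2)%R.
  have [z zE] := surjU 0%R.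
  have e0 : (0 < (2 * rhoU t)^-1)%R by rewrite invr_gt0 mulr_gt0.
  have [x Cx ax] : exists2 x, C x & a <' x.
    by apply: g2; rewrite (mltE (model ext0)) aE; lra.
  have : ~ C b.
    by move=> /g1; rewrite (nmltE (model ext0)) bE; lra.
  rewrite CE => /existsNP[v /not_implyP[Sv]].
  rewrite (nmltE (model I)) => vb; exists v => //.
  have := (CE x).1 Cx v Sv; rewrite (mltE (model I)) => xv.
  move: ax; rewrite (mltE (model ext0)) -iota_lt => ax.
  have i0 := iota0 zE; have i1 := iota1 lE.
  have it0 : (0 < iota t)%R by rewrite -i0 iota_lt zE.
  have e1 : (iota h + iota h = iota l)%R by apply: iota_eqD; rewrite hE lE; lra.
  have e2 : (iota t * iota e = iota h)%R.
    by apply: iota_eqM; rewrite eE hE invfM mulrCA divff ?gt_eqF // mulr1 mul1r.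
  have e3 : (iota g + iota e = iota b)%R by apply: iota_eqD; rewrite eE bE.
  have e4 : (iota a + iota e = iota g)%R by apply: iota_eqD; rewrite eE aE; lra.
  apply/iota_close; split; last by split; nra.
  move=> /(@rho_inj _ _ _ (model I)) vg; case: Sv => + _.
  by rewrite vg; apply: Y_nonstandard.
have Gg : limit_point (K := ext0) d g.
  move=> t /close_g[v [Yv _] hv].
  by apply/G0E; exists v.
have [v [Yv nv] hv] := close_g u u0; apply: nv; right; right.
exists (emb I g); split=> //.
have := (dfn_hom (I := ext0) (oapp d g) dfn_limit_point (emb_hom I)).1 Gg.
exact.
Qed.

End Near.

(** [V] is [near]. The tuple [s] has been eliminated from it at the cost of a level [t], which
    [core] will choose definably from [b]. *)
Lemma approximation (A : set U) (I : ext) X Z (s : X -> I)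
    (R : forall K : ext, (X + option Z -> K) -> Prop) :
  definable_tuple A s -> dfn A R ->
  exists V : forall K : ext, (Z -> K) -> K -> K -> Prop,
    [/\ dfn A (fun K (v : option (option Z) -> K) =>
          V K (v \o Some \o Some) (v (Some None)) (v None)),
        forall (K : ext) z t t' w, mzero O K <' t -> ~ t' <' t -> V K z t' w -> V K z t w &
        forall d : Z -> U, (forall u, ~ R I (join s (oapp (emb I \o d) (emb I u)))) ->
          (forall w, exists u, mzero O U <' u /\ ~ V ext0 d u w) /\
          (forall u w, mzero O U <' u -> R I (join s (oapp (emb I \o d) w)) ->
             V I (emb I \o d) (emb I u) w)].
Proof.
move=> hs dfn_R.
pose RG (K : ext) (v : X + option (option Z) -> K) := exists w : K,
  R K (join (v \o inl) (oapp (v \o inr \o Some \o Some) w)) /\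
  close (v (inr (Some None))) (v (inr None)) w.
have dfn_RG : dfn A RG.
  apply: dfn_ex; apply: dfn_and; last by apply: dfn_close; exact: tdfn_var.
  apply: (dfn_app (f := fun x : X + option Z => match x with inl x => Some (inl x)
    | inr (Some z) => Some (inr (Some (Some z))) | inr None => None end) dfn_R).
  by move=> K v [x|[z|]].
have [G0 [dfn_G0 G0E]] := hs _ _ dfn_RG.
exists (near G0); split=> [||d hd]; [exact: dfn_near|exact: near_mono|].
split; first exact: (@near_exit A I X Z s R dfn_R G0 G0E d hd).
exact: (@near_cover A I X Z s R hs dfn_R G0 dfn_G0 G0E d hd).

Qed.

End Approximation.


(** * Domination by non-realised types *)

Section Domination.
Variables (L : language) (O : oring_symbols L) (U : structure L).
Local Notation ext := (ext U).
Local Notation zero := (mzero O _).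
Local Notation one := (mone O _).
Local Notation "x <' y" := (mlt O x y) (at level 70).
Local Notation "x +' y" := (madd O x y) (at level 50, left associativity).
Hypothesis model : forall I : ext, rcf_model O I.
Hypothesis omin : forall I : ext, ominimal O I.
Local Notation rho I := (rho (model I)).

Section Core.
Variables (A : set U) (N J : ext) (j : N -> J) (X Y : Type).
Variables (c : X -> J) (b : Y -> N).
Hypothesis hj : ext_hom j.
Hypothesis hc : forall Z (R : forall K : ext, (X + Z -> K) -> Prop), dfn A R ->
  exists Q : forall K : ext, (Z -> K) -> Prop,
    dfn A Q /\ forall n : Z -> N, Q N n <-> R J (join c (j \o n)).
Hypothesis hb : definable_tuple A b.
Variable y0 : Y.
Hypothesis b_nonstandard : forall u : U, b y0 <> emb N u.

(** [hc] removes [c] in favour of elements of [N], then [hb] removes [b] in favour of elements of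
    [U]. *)
Lemma definable_pair : definable_tuple A (join c (j \o b)).
Proof.
move=> Z R dfn_R.
pose R1 (K : ext) (v : X + (Y + Z) -> K) :=
  R K (join (join (v \o inl) (v \o inr \o inl)) (v \o inr \o inr)).
have [|Q [dfn_Q hQ]] := @hc _ R1.
  apply: (dfn_app (f := fun x => match x with inl (inl x) => inl x
    | inl (inr y) => inr (inl y) | inr z => inr (inr z) end) dfn_R).
  by move=> K v [[x|y]|z].
have [Q' [dfn_Q' hQ']] := hb dfn_Q.
exists Q'; split=> // d; rewrite hQ' hQ /R1.
by rewrite -(ext_hom_emb hj).
Qed.

(** [approximation] is applied to the singleton of the nonstandard coordinate [b y0]. At [b] every
    positive level of [U] is attained, while a coordinate in [U] leaves the neighbourhoods at some
    level. The levels at [b] are thus bounded in [N], but by nothing in [U]. *)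
Lemma unbounded_level : exists H : forall K : ext, (Y -> K) -> K -> Prop,
  [/\ dfn A (fun K (v : option Y -> K) => H K (v \o Some) (v None)),
      forall u : U, mzero O U <' u -> H N b (emb N u) &
      forall (K : ext) y, exists u, forall t, H K y t -> ~ u <' t].
Proof.
have [|V [dfn_V V_mono hV]] := approximation model omin hb
    (R := fun K (v : Y + option void -> K) => v (inr None) = v (inl y0)).
  by apply: dfn_eq; exact: tdfn_var.
have [|exitV coverV] := hV (of_void U).
  by move=> u /= e; apply: (b_nonstandard (esym e)).
pose H (K : ext) (y : Y -> K) (t : K) := V K (of_void K) t (y y0).
have dfn_H : dfn A (fun K (v : option Y -> K) => H K (v \o Some) (v None)).
  pose f (x : option (option void)) : option Y :=
    match x with None => Some y0 | Some None => None | Some (Some z) => of_void _ z end.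
  apply: (dfn_sub (f := f) dfn_V) => K v.
  rewrite /H (_ : of_void K = (v \o f) \o Some \o Some) //.
  by apply: funext => -[].
exists H; split=> // [u u0|].
  rewrite /H (_ : of_void N = emb N \o of_void U); last by apply: funext => -[].
  exact: coverV.
(* Boundedness of the levels is first order, so it is enough to verify it for tuples of [U]. *)
apply: (@dfn_valid _ _ A _ (fun K y => exists u, forall t, H K y t -> ~ u <' t)).
  apply: dfn_ex; apply: dfn_all; apply: dfn_imp.
    apply: (dfn_sub (f := fun x => if x is Some y then Some (Some y) else None) dfn_H).
    by [].
  by apply: dfn_not; apply: dfn_lt; exact: tdfn_var.
move=> y; have [u [u0 hu]] := exitV (y y0).
exists u => t Ht ut; apply: hu; apply: V_mono Ht => // tu.
move: ut tu; rewrite !(mltE (model ext0)) => h1 h2.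
by have := lt_trans h1 h2; rewrite ltxx.
Qed.

(** Induction on [m]. The coordinate [ord0] is treated by [approximation] for the pair of [c] and
    [b], with the other coordinates as parameters. The resulting [R'] is correct when these lie in
    [U]; the tuples at which it fails to cover [R] form a relation in one variable less without
    solution in [U], left to the induction hypothesis. *)
Lemma core m (R : forall K : ext, (X + (Y + 'I_m) -> K) -> Prop) : dfn A R ->
  (forall d : 'I_m -> U, ~ R J (join c (join (j \o b) (emb J \o d)))) ->
  exists R' : forall K : ext, (Y + 'I_m -> K) -> Prop,
    [/\ dfn A R',
        forall d : 'I_m -> U, ~ R' N (join b (emb N \o d)) &
        forall z : 'I_m -> J, R J (join c (join (j \o b) z)) -> R' J (join (j \o b) z)].
Proof.
have [H [dfn_H H_large H_bounded]] := unbounded_level.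
elim: m R => [|m IH] R dfn_R hR.
  exists (fun K v => False); split=> [|d []|z]; first exact: dfn_false.
  rewrite (_ : z = emb J \o (fun i : 'I_0 => match notF (ltn_ord i) with end)).
    exact: hR.
  by apply: funext => -[].
have [|V [dfn_V V_mono hV]] := approximation model omin definable_pair
    (R := fun K (v : X + Y + option 'I_m -> K) =>
      R K (join (v \o inl \o inl) (join (v \o inl \o inr) (fun i => v (inr (unlift ord0 i)))))).
  apply: (dfn_app (f := fun x => match x with inl x => inl (inl x)
    | inr (inl y) => inl (inr y) | inr (inr i) => inr (unlift ord0 i) end) dfn_R).
  by move=> K v [x|[y|i]].
pose cons (K : ext) (z : 'I_m -> K) (w : K) : 'I_m.+1 -> K := fun i => oapp z w (unlift ord0 i).
have nonstandard (d : 'I_m -> U) u :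
    ~ R J (join c (join (j \o b) (cons J (emb J \o d) (emb J u)))).
  rewrite (_ : cons J _ _ = emb J \o cons ext0 d u) //.
  by apply: funext => i; rewrite /cons /=; case: unlift.
have exitV d := (hV d (nonstandard d)).1.
have coverV d := (hV d (nonstandard d)).2.
(* [RF] says that [V] at level [t] covers all solutions of [R]; [QF] is the same condition after the
   elimination of [c]. *)
pose RF (K : ext) (v : X + (Y + option 'I_m) -> K) := forall w : K,
  R K (join (v \o inl) (join (v \o inr \o inl) (cons K (v \o inr \o inr \o Some) w))) ->
  V K (v \o inr \o inr \o Some) (v (inr (inr None))) w.
have [|QF [dfn_QF hQF]] := @hc _ RF.
  apply: dfn_all; apply: dfn_imp.
    apply: (dfn_app (f := fun x => match x with inl x => Some (inl x)
      | inr (inl y) => Some (inr (inl y))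
      | inr (inr i) => omap (fun i => inr (inr (Some i))) (unlift ord0 i) end) dfn_R).
    by move=> K v [x|[y|i]] //=; rewrite /cons; case: unlift.
  apply: (dfn_sub (f := fun x => match x with None => None
    | Some None => Some (inr (inr None))
    | Some (Some i) => Some (inr (inr (Some i))) end) dfn_V).
  by [].
(* Call a positive level good if it satisfies [H] and [QF]. [B] says that twice its last argument
   bounds the good levels. *)
pose B (K : ext) (v : Y + option 'I_m -> K) := forall t : K, zero <' t ->
  H K (v \o inl) t -> QF K (join (v \o inl) (oapp (v \o inr \o Some) t)) ->
  ~ v (inr None) +' v (inr None) <' t.
have dfn_B : dfn A B.
  apply: dfn_all; apply: dfn_imp; [|apply: dfn_imp; [|apply: dfn_imp]].
  - by apply: dfn_lt; [exact: tdfn0|exact: tdfn_var].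
  - apply: (dfn_sub (f := fun x => if x is Some y then Some (inl y) else None) dfn_H).
    by [].
  - apply: (dfn_app (f := fun x => match x with inl y => Some (inl y)
      | inr (Some i) => Some (inr (Some i)) | inr None => None end) dfn_QF).
    by move=> K v [y|[i|]].
  by apply: dfn_not; apply: dfn_lt; [apply: tdfnD|]; exact: tdfn_var.
(* [R'] uses levels [s] of at least half the supremum of the good ones. At [b] and parameters from
   [U] they exceed all of [U], so that no standard point remains; and half the supremum lies below
   some good level, so that the solutions of [R] are covered. Without the factor 2 the supremum
   would have to be attained. *)
pose R' (K : ext) (v : Y + option 'I_m -> K) := exists s : K, zero <' s /\
  (B K (join (v \o inl) (oapp (v \o inr \o Some) s)) /\
   V K (v \o inr \o Some) s (v (inr None))).
have dfn_R' : dfn A R'.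
  apply: dfn_ex; apply: dfn_and; [|apply: dfn_and].
  - by apply: dfn_lt; [exact: tdfn0|exact: tdfn_var].
  - apply: (dfn_app (f := fun x => match x with inl y => Some (inl y)
      | inr (Some i) => Some (inr (Some i)) | inr None => None end) dfn_B).
    by move=> K v [y|[i|]].
  apply: (dfn_sub (f := fun x => match x with None => Some (inr None)
    | Some None => None | Some (Some i) => Some (inr (Some i)) end) dfn_V).
  by [].
have F_standard (d : 'I_m -> U) u : mzero O U <' u ->
    QF N (join b (oapp (emb N \o d) (emb N u))).
  move=> u0; rewrite hQF /RF => w hw.
  rewrite (_ : j \o _ = join (j \o b) (oapp (emb J \o d) (emb J u))) in hw *.
    exact: coverV.
  by apply: funext => -[y|[i|]] //=; rewrite -(ext_hom_emb hj).
have emb_pos (K : ext) (u : U) : mzero O U <' u -> zero <' emb K u.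
  by move=> u0; rewrite -(hom0 O (emb_hom K)) (hom_lt O (emb_hom K)).
have R'_exit (d : 'I_m -> U) u : ~ R' N (join b (oapp (emb N \o d) (emb N u))).
  move=> [s [s0 [/= hB hVs]]]; have [v [v0 hv]] := exitV d u.
  apply: hv; apply/(dfn_hom (I := ext0) (oapp (oapp d v) u) dfn_V (emb_hom N)).
  apply: V_mono hVs => /=; first exact: emb_pos.
  (* The element [v + v] of [U] is a good level, so by [B] the level [s] cannot be below [v]. *)
  move=> sv; apply: (hB (emb N (v +' v))).
  - apply: emb_pos; move: v0; rewrite !(mltE (model ext0)) !rhoE => v0; lra.
  - apply: H_large; move: v0; rewrite !(mltE (model ext0)) !rhoE => v0; lra.
  - apply: F_standard; move: v0; rewrite !(mltE (model ext0)) !rhoE => v0; lra.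
  rewrite /= (homD O (emb_hom N)); move: sv.
  by rewrite !(mltE (model N)) !rhoE => sv; lra.
have R'_cover (d : 'I_m -> U) w :
    R J (join c (join (j \o b) (cons J (emb J \o d) w))) ->
    R' J (join (j \o b) (oapp (emb J \o d) w)).
  move=> hw.
  have one0 : mzero O U <' one by rewrite (mltE (model ext0)) !rhoE ltr01.
  (* The good levels: [one] is among them and [H] bounds them, so they have a positive supremum,
     half of which serves as [s]. *)
  pose S := [set t : N | zero <' t /\ (H N b t /\ QF N (join b (oapp (emb N \o d) t)))].
  have S1 : S (emb N one).
    by split; [exact: emb_pos|split; [exact: H_large|exact: F_standard]].
  have [sigma [sigma1 sigma2]] : exists s, is_sup O S s.
    apply: (sup_exists (model N) (@omin N)); last 2 first.
    - by exists (emb N one).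
    - by have [u hu] := H_bounded N b; exists u => x [_ [/hu]].
    apply: (@dfn_msection _ _ A _ (fun (K : ext) (v : Y + 'I_m -> K) (t : K) => zero <' t /\
      (H K (v \o inl) t /\ QF K (join (v \o inl) (oapp (v \o inr) t)))) N
      (join b (emb N \o d))).
    apply: dfn_and; [|apply: dfn_and].
    - by apply: dfn_lt; [exact: tdfn0|exact: tdfn_var].
    - apply: (dfn_sub (f := fun x => if x is Some y then Some (inl y) else None) dfn_H).
      by [].
    apply: (dfn_app (f := fun x => match x with inl y => Some (inl y)
      | inr (Some i) => Some (inr i) | inr None => None end) dfn_QF).
    by move=> K v [y|[i|]].
  have [s sE] := @rho_surj _ _ _ (model N) (rho N sigma / 2)%R.
  have sg0 : (0 < rho N sigma)%R.
    have := sigma1 _ S1; rewrite (nmltE (model N)) (hom1 O (emb_hom N)) rhoE.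
    by move=> h; lra.
  have s0 : zero <' s by rewrite (mltE (model N)) rhoE sE; lra.
  (* At the good level [t] the point [w] is covered by [V], hence also at the smaller level [s]. *)
  have [t [t0 [Ht Ft]] st] : exists2 t, S t & s <' t.
    by apply: sigma2; rewrite (mltE (model N)) sE; lra.
  exists (j s); split; first by rewrite -(hom0 O hj) (hom_lt O hj).
  split.
    rewrite (_ : join _ _ = j \o join b (oapp (emb N \o d) s)); last first.
      by apply: funext => -[y|[i|]] //=; rewrite -(ext_hom_emb hj).
    apply/(dfn_hom _ dfn_B hj) => t' t'0 Ht' Ft' /=.
    have := sigma1 t' (conj t'0 (conj Ht' Ft')).
    by rewrite !(nmltE (model N)) !rhoE sE => h; lra.
  move: Ft; rewrite hQF /RF.
  rewrite (_ : j \o _ = join (j \o b) (oapp (emb J \o d) (j t))); last first.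
    by apply: funext => -[y|[i|]] //=; rewrite -(ext_hom_emb hj).
  move=> /(_ w hw); apply: V_mono; first by rewrite -(hom0 O hj) (hom_lt O hj).
  rewrite (hom_lt O hj); move: st; rewrite !(mltE (model N)) => h1 h2.
  by have := lt_trans h1 h2; rewrite ltxx.
(* [R1] holds where [R'] fails to cover [R]; by [R'_cover] this happens for no tuple of [U]. *)
pose R1 (K : ext) (v : X + (Y + 'I_m) -> K) := ~ forall w : K,
  R K (join (v \o inl) (join (v \o inr \o inl) (cons K (v \o inr \o inr) w))) ->
  R' K (join (v \o inr \o inl) (oapp (v \o inr \o inr) w)).
have [||R'' [dfn_R'' R''_exit R''_cover]] := IH R1.
- apply: dfn_not; apply: dfn_all; apply: dfn_imp.
    apply: (dfn_app (f := fun x => match x with inl x => Some (inl x)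
      | inr (inl y) => Some (inr (inl y))
      | inr (inr i) => omap (fun i => inr (inr i)) (unlift ord0 i) end) dfn_R).
    by move=> K v [x|[y|i]] //=; rewrite /cons; case: unlift.
  apply: (dfn_app (f := fun x => match x with inl y => Some (inr (inl y))
    | inr (Some i) => Some (inr (inr i)) | inr None => None end) dfn_R').
  by move=> K v [y|[i|]].
- by move=> d; apply=> w; exact: R'_cover.
exists (fun K v => R'' K (join (v \o inl) (v \o inr \o lift ord0)) \/
  R' K (join (v \o inl) (oapp (v \o inr \o lift ord0) (v (inr ord0))))).
split=> [|d|z hz].
- apply: dfn_or.
    apply: (dfn_app (f := fun x => match x with inl y => inl y
      | inr i => inr (lift ord0 i) end) dfn_R'').
    by move=> K v [y|i].
  apply: (dfn_app (f := fun x => match x with inl y => inl y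
      | inr (Some i) => inr (lift ord0 i) | inr None => inr ord0 end) dfn_R').
  by move=> K v [y|[i|]].
- case=> [|h]; first exact: R''_exit.
  exact: (R'_exit (d \o lift ord0) (d ord0)).
have zE : z = cons J (z \o lift ord0) (z ord0).
  by apply: funext => i; rewrite /cons; case: (unliftP ord0 i) => [k|] ->.
have [h|h] := pselect (R1 J (join c (join (j \o b) (z \o lift ord0)))).
  by left; exact: R''_cover.
right; apply: contrapT => nR'; apply: h => h; apply: nR'; apply: (h (z ord0)).
by move: hz; rewrite {1}zE.
Qed.

End Core.
End Domination.
(** * Invariant types, products and domination *)

Section Monster.
Variables (L : language) (U : structure L) (K : Type).
Hypothesis U_monster : monster K U.
Local Notation ext := (ext U).

Let K_limit : strong_limit K. Proof. by case: U_monster. Qed.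
Let K_large : theory_small K L. Proof. by case: U_monster. Qed.
Let U_saturated : saturated K U. Proof. by case: U_monster. Qed.
Let U_homogeneous : strongly_homogeneous K U. Proof. by case: U_monster. Qed.

Lemma automorphism_elementary (s : U -> U) : automorphism s -> elementary s.
Proof.
move=> [[g gs sg] sf sr].
suff main V (phi : formula L V) (v : V -> U) : sat v phi <-> sat (s \o v) phi.
  by move=> phi; exact: (main _ phi id).
have ht W (t : term L W) (w : W -> U) : s (teval w t) = teval (s \o w) t.
  by elim: t => //= k f ts IH; rewrite sf; congr finterp; apply: funext.
elim: phi v => [W|W t1 t2|W k R ts|W phi IH1 psi IH2|W phi IH] v /=.
- by [].
- by rewrite -!ht; split=> [->//|/(can_inj gs)].
- rewrite (sr _ R).
  by rewrite (_ : s \o _ = fun i => teval (s \o v) (ts i)) //; apply: funext => i; rewrite /= ht.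
- by rewrite IH1 IH2.
have E a : s \o oapp v a = oapp (s \o v) (s a) by apply: funext; case.
by split=> h a; [rewrite -(sg a) -E -IH|rewrite IH E].
Qed.

Lemma definable_invariant (A : set U) (p : gset U) : definable_over A p -> Defs.invariant A p.
Proof.
move=> hp s hs fix_s phi; have [chi h] := definable_scheme phi hp.
rewrite -{1}[phi]prename_id !h.
rewrite -(elementary_sat (join id _) chi (automorphism_elementary hs)) join_comp.
rewrite (_ : s \o @set_val U A = @set_val U A) //; apply: funext => a.
by apply: fix_s; apply: set_mem; apply: valP.
Qed.

Lemma tuple_type_complete (A : set U) (I : ext) n (c : 'I_n -> I) :
  complete_type (@set_val U A) [set phi | sat (join c (emb I \o @set_val U A)) phi].
Proof.
split=> [F finF Fc|phi]; last first.
  by have [] := pselect (sat (join c (emb I \o @set_val U A)) phi); [left|right].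
have [psi h] := finite_conjunction finF.
have [|a ha] := @elementary_exists _ _ _ _ n _ (@set_val U A) psi (embP I).
  by exists c; apply/h.
by exists a => phi Fphi; apply: (h _ _).1 ha _ Fphi.
Qed.

Lemma sum_type_complete (A : set U) (I : ext) n m (c : 'I_n + 'I_m -> I) :
  complete_type (@set_val U A) [set phi | sat (join c (emb I \o @set_val U A)) phi].
Proof.
have [fs _] := tuple_type_complete A (c \o @fintype.split n m).
split=> [F finF Fc|phi]; last first.
  by have [] := pselect (sat (join c (emb I \o @set_val U A)) phi); [left|right].
have [|a ha] := fs _ (finite_image (vrename (@unsplit n m)) finF).
  move=> _ [phi /Fc hphi <-] /=; rewrite sat_vrename.
  by rewrite (_ : _ \o unsplit = c) //; apply: funext => x; rewrite /= unsplitK.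
exists (a \o @unsplit n m) => phi Fphi.
by rewrite -sat_vrename; apply: ha; exists phi.
Qed.

Lemma small_realisation (A : set U) (I : ext) n (c : 'I_n -> I) : small K A ->
  exists d : 'I_n -> U,
    same_type (join d (@set_val U A)) (join c (emb I \o @set_val U A)).
Proof.
move=> sA; have [fs cpl] := tuple_type_complete A c.
have [d hd] := U_saturated sA fs; exists d => phi; split=> [h|]; last exact: hd.
by have [//|/hd hn] := cpl phi; case: (hn h).
Qed.

(** Strong homogeneity concerns maps on a subset of [U], so each element of [B] is given a name in
    ['I_n + A] and sent to what this name denotes for [d']. Equality of types makes the choice of
    names immaterial. *)
Lemma same_type_automorphism (A : set U) n (d d' : 'I_n -> U) : small K A ->
  same_type (join d (@set_val U A)) (join d' (@set_val U A)) ->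
  exists s : U -> U, [/\ automorphism s, forall x, A x -> s x = x & s \o d = d'].
Proof.
move=> sA dd'.
pose B := A `|` range d.
have sB : small K B.
  by apply: (smallU K_limit K_large sA); apply: (finite_small K_large);
  apply: finite_image; apply: finite_finset.
have /choice[h hE] (x : B) : exists z : 'I_n + A, join d (@set_val U A) z = set_val x.
  have [Ax|[i _ e]] : B (set_val x) by apply: set_mem; apply: valP.
    by exists (inr (SigSub (mem_set Ax))).
  by exists (inl i).
have [|s [aut_s sE]] := U_homogeneous sB (f := join d' (@set_val U A) \o h).
  move=> phi; have := dd' (rename h phi); rewrite !sat_rename.
  by rewrite (_ : join d _ \o h = set_val) //; apply: funext.
have eq_of z z' : join d (@set_val U A) z = join d (@set_val U A) z' ->
    join d' (@set_val U A) z = join d' (@set_val U A) z'.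
  exact: (dd' (Equ (Var L z) (Var L z'))).1.
exists s; split=> // [x Ax|].
  have Bx : x \in B by apply/mem_set; left.
  rewrite (sE (SigSub Bx)) /=.
  by have := eq_of _ (inr (SigSub (mem_set Ax))) (hE (SigSub Bx)).
apply: funext => i; have Bx : d i \in B by apply/mem_set; right; exists i.
rewrite /= (sE (SigSub Bx)) /=.
by have := eq_of _ (inl i) (hE (SigSub Bx)).
Qed.

(** * Products of definable types *)

Section Tensor.
Variables (A : set U) (p q : gset U).
Hypotheses (sA : small K A) (hp : definable_over A p) (p_global : global_type p).

Definition pair_tuple (N J : ext) (j : N -> J) (c : 'I_(gdim p) -> J)
    (b : 'I_(gdim q) -> N) : 'I_(gdim p + gdim q) -> J :=
  join c (j \o b) \o @fintype.split _ _.

Let regroup (phi : formula L ('I_(gdim p + gdim q) + U)) :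
    formula L ('I_(gdim p) + ('I_(gdim q) + U)) :=
  rename (join (fun i => join inl (inr \o inl) (fintype.split i)) (inr \o inr)) phi.

Let sat_regroup (N J : ext) (j : N -> J) c b phi : ext_hom j ->
  sat (join (pair_tuple j c b) (emb J)) phi <->
  sat (join c (j \o join b (emb N))) (regroup phi).
Proof.
move=> hj; rewrite sat_rename (_ : _ \o join _ _ = join (pair_tuple j c b) (emb J)) //.
apply: funext => -[i|u] /=; last by rewrite -(ext_hom_emb hj).
by rewrite /pair_tuple /=; case: fintype.split.
Qed.

(** The scheme of [p] turns [phi] into a condition on [b] alone, the same for all realisations, so
    the type of the pair depends only on that of [b] over [U]. *)
Let heir_tensor (phi : formula L ('I_(gdim p + gdim q) + U)) :
  exists delta : formula L ('I_(gdim q) + U), forall (N J : ext) (j : N -> J) c b,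
    ext_hom j -> heir A j c ->
    sat (join (pair_tuple j c b) (emb J)) phi <-> sat (join b (emb N)) delta.
Proof.
have [chi h] := definable_scheme (regroup phi) hp.
exists (rename (join id (inr \o @set_val U A)) chi) => N J j c b hj hc.
rewrite (sat_regroup _ _ _ hj) -(hc _ _ _ h) sat_rename.
by rewrite (_ : _ \o join _ _ = join (join b (emb N)) (emb N \o @set_val U A)) //;
  apply: funext => -[].
Qed.

(** The definition of [tensor] allows any realisation of [q] and any small set [A'] of invariance.
    [heir_tensor] deals with the former, and an automorphism over [A'] with the latter. *)
Lemma tensor_gtp (N J : ext) (j : N -> J) (c : 'I_(gdim p) -> J) (b : 'I_(gdim q) -> N) :
  ext_hom j -> heir A j c -> (forall phi, gforms q phi <-> sat (join b (emb N)) phi) ->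
  tensor K p q = gtp (pair_tuple j c b).
Proof.
move=> hj hc hb; congr GSet; apply/seteqP.
have [q_fs q_cpl] : complete_type (@id U) (gforms q).
  rewrite (_ : gforms q = gforms (gtp b)); first exact: gtp_global.
  by apply/seteqP; split=> phi /= /hb.
split=> phi /=; have [delta hdelta] := heir_tensor phi.
  move=> [N' [e [b' [A' [he hb' sA' inv_p [k [psi [beta [d [_ eq st pd]]]]]]]]]].
  rewrite (hdelta _ _ _ _ _ hj hc) -hb.
  suff : sat (join b' e) delta.
    by move=> h; have [//|/hb' hn] := q_cpl delta; case: (hn h).
  pose I' := Ext he; have [J' [j' [c' [hj' hc']]]] := heir_exists I' p_global hp.
  rewrite -(hdelta I' J' j' c' b' hj' hc') (sat_regroup _ _ _ hj').
  have -> : sat (join c' (j' \o join b' e)) (regroup phi) <->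
      sat (join c' j') (subst_right e b' phi).
    rewrite !sat_rename; set v := _ \o _; set w := _ \o _.
    suff -> : v = w by [].
    by apply: funext => -[i|u] //=; rewrite /v /w /=; case: fintype.split.
  rewrite eq sat_prename; have [chi h] := definable_scheme psi hp.
  rewrite -(hc' _ _ _ h).
  (* [d] matches [beta] over [A'], whereas the scheme of [p] is over [A]. The tuple [d0] matches
     [beta] over both; it is conjugate to [d] over [A'], and [p] is [A']-invariant. *)
  have [d0 hd0] := small_realisation (I := I') beta (smallU K_limit K_large sA sA').
  have sub (B : set U) (AB : B `<=` A `|` A') :
      same_type (join d0 (@set_val U B)) (join beta (e \o @set_val U B)).
    have hB (a : B) : set_val a \in A `|` A' by apply/mem_set/AB/set_mem/valP.
    move=> theta.
    have := hd0 (prename (fun a => SigSub (hB a) : (A `|` A' : set U)) theta).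
    by rewrite !sat_prename.
  have [|s [aut_s fix_s sE]] := same_type_automorphism (d := d) (d' := d0) sA'.
    move=> theta; rewrite (st theta); apply: iff_sym.
    exact: (sub A' (@subsetUr _ _ _)).
  rewrite -(sub A (@subsetUl _ _ _)) -h -sE -prename_comp.
  exact: (inv_p s aut_s fix_s _).1.
move=> hphi; exists N, (emb N), b, A; split=> //; first exact: embP.
- by move=> psi /hb.
- exact: definable_invariant.
have [k [phi0 [g [_ eq]]]] := finite_support (regroup phi).
have [d hd] := small_realisation (join b (emb N) \o g) sA.
exists k, phi0, (join b (emb N) \o g), d; split.
- by move=> i /=; case: (g i) => x; [right; exists x|left; exists x].
- rewrite -prename_comp -eq /subst_right /regroup /prename rename_comp.
  by congr rename; apply: funext => -[i|u] //=; case: fintype.split.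
- exact: hd.
have [chi h] := definable_scheme phi0 hp.
rewrite h hd (hc _ _ _ h).
by move: hphi; rewrite (sat_regroup _ _ _ hj) eq sat_prename.
Qed.

End Tensor.

Lemma heir_gtp (A : set U) (p : gset U) (I : ext) (c : 'I_(gdim p) -> I) :
  (forall phi, gforms p phi <-> sat (join c (emb I)) phi) ->
  heir A (I := ext0) (emb I) c.
Proof. by move=> h W psi chi hchi w; rewrite -hchi h sat_prename. Qed.

Lemma gtp_definable_tuple (A : set U) (p : gset U) (I : ext) (c : 'I_(gdim p) -> I) :
  definable_over A p -> (forall phi, gforms p phi <-> sat (join c (emb I)) phi) ->
  definable_tuple A c.
Proof.
move=> hp hc Z R dfn_R.
exact: (@heir_dfn _ _ A p ext0 I (emb I) c hp (emb_hom I) (heir_gtp hc) Z R dfn_R).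
Qed.

Lemma definable_tuple_gtp (A : set U) (I : ext) n (c : 'I_n -> I) :
  definable_tuple A c -> definable_over A (gtp c).
Proof.
move=> hc m phi.
have [|Q [[psi hpsi] hQ]] := hc 'I_m (fun K v => sat v phi).
  by exists (rename inl phi) => I' v; rewrite sat_rename.
exists psi => d; rewrite /= sat_prename -hQ.
exact: hpsi ext0 d.
Qed.

Lemma definable_tuple_comp (A : set U) (I : ext) X Y (c : X -> I) (f : Y -> X) :
  definable_tuple A c -> definable_tuple A (c \o f).
Proof.
move=> hc Z R dfn_R.
have [|Q [dfn_Q hQ]] := hc Z (fun K v => R K (join (v \o inl \o f) (v \o inr))).
  apply: (dfn_app (f := fun z => match z with inl y => inl (f y) | inr z => inr z end) dfn_R).
  by move=> I' v [].
by exists Q.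
Qed.

Lemma tensor_realisation (p q : gset U) : definable_type K p -> definable_type K q ->
  exists (A : set U) (N J : ext) (j : N -> J) (c : 'I_(gdim p) -> J) (b : 'I_(gdim q) -> N),
    [/\ small K A, ext_hom j,
        definable_over A p /\ definable_over A q,
        (forall phi, gforms q phi <-> sat (join b (emb N)) phi) /\ heir A j c &
        (forall phi, gforms p phi <-> sat (join c (emb J)) phi) /\
        tensor K p q = gtp (pair_tuple j c b)].
Proof.
move=> [gp [A [sA hA]]] [gq [B [sB hB]]].
have dp := definable_sub (@subsetUl _ A B) hA.
have dq := definable_sub (@subsetUr _ A B) hB.
have sAB := smallU K_limit K_large sA sB.
have [N [b hb]] := global_realisation gq.
have [J [j [c [hj hc]]]] := heir_exists N gp dp.
exists (A `|` B), N, J, j, c, b; split=> //; split; first exact: heir_sat hc.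
exact: tensor_gtp hc hb.
Qed.

Lemma tensor_definable (p q : gset U) : definable_type K p -> definable_type K q ->
  definable_type K (tensor K p q).
Proof.
move=> dp dq.
have [A [N [J [j [c [b [sA hj [hp hq] [hb hc] [_ e]]]]]]]] := tensor_realisation dp dq.
rewrite e; split; first exact: gtp_global.
exists A; split=> //; apply: definable_tuple_gtp; apply: definable_tuple_comp.
apply: (definable_pair hj); last exact: gtp_definable_tuple hb.
by move=> Z R; apply: heir_dfn.
Qed.

Lemma realised_tuple (p : gset U) (I : ext) (c : 'I_(gdim p) -> I) :
  (forall phi, gforms p phi <-> sat (join c (emb I)) phi) ->
  realised p <-> forall i, exists u, c i = emb I u.
Proof.
move=> hc; have -> : realised p <-> realised (gtp c) by rewrite -(global_type_eq hc).
rewrite realised_gtp; split=> [[a ->] i|/choice[a ha]]; first by exists (a i).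
by exists a; apply: funext.
Qed.

Lemma tensor_realised (p q : gset U) : definable_type K p -> definable_type K q ->
  realised (tensor K p q) <-> realised p /\ realised q.
Proof.
move=> dp dq.
have [A [N [J [j [c [b [sA hj _ [hb hc] [hc' e]]]]]]]] := tensor_realisation dp dq.
rewrite (realised_tuple hc') (realised_tuple hb) e.
have -> := @realised_tuple (gtp (pair_tuple j c b)) J (pair_tuple j c b) (fun phi => iff_refl _).
split=> [h|[hcu hbu] i].
  split=> i.
    have [u hu] := h (lshift _ i); exists u; move: hu.
    by rewrite /pair_tuple /= (unsplitK (inl i)).
  have [u hu] := h (rshift _ i); exists u; move: hu.
  rewrite /pair_tuple /= (unsplitK (inr i)) /= -(ext_hom_emb hj).
  exact: elementary_inj (ext_hom_elementary hj) _ _.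
rewrite /pair_tuple /=; case: fintype.split => k /=; first exact: hcu.
by have [u ->] := hbu k; exists u; rewrite -(ext_hom_emb hj).
Qed.

(** By saturation [r] has a realisation in [U]. Its first half has the type of [a] over [A], so an
    automorphism over [A] moves it to [a]; the image of the second half then realises [q], by
    domination in [U] itself. *)
Lemma dominates_realised (p q : gset U) : global_type p -> dominates K p q ->
  realised p -> realised q.
Proof.
move=> [_ p_cpl] [A [r [sA [r_fs r_cpl] rp rq dom]]] [a ha].
(* Saturation is stated for variables in ['I_n], so the variables of [r] are renumbered. *)
pose r' := [set phi | r (vrename (@fintype.split (gdim p) (gdim q)) phi)].
have [F finF Fr|c hc] := U_saturated sA (p := r').
  have [|v hv] := r_fs _ (finite_image (vrename (@fintype.split _ _)) finF).
    by move=> _ [phi Fphi <-]; apply: Fr.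
  exists (v \o @fintype.split _ _) => phi Fphi.
  by rewrite -sat_vrename; apply: hv; exists phi.
have hr phi : r phi -> sat (join (c \o @unsplit _ _) (@set_val U A)) phi.
  move=> rphi; rewrite -sat_vrename; apply: hc.
  rewrite /r' /= /vrename rename_comp (_ : _ \o _ = id) ?rename_id //.
  by apply: funext => -[x|] //=; rewrite unsplitK.
have hp phi : sat (join a (@set_val U A)) phi -> Defs.restrict A p phi.
  move=> h; have [//|/ha] := p_cpl (prename (@set_val U A) phi).
  by rewrite sat_neg sat_prename.
have [|s [aut_s fix_s sE]] :=
    @same_type_automorphism A _ (c \o @unsplit _ _ \o inl) a sA.
  have main phi : sat (join a (@set_val U A)) phi ->
      sat (join (c \o @unsplit _ _ \o inl) (@set_val U A)) phi.
    by move=> /hp/rp/hr; rewrite sat_vrename.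
  move=> phi; split=> [h|]; last exact: main.
  by apply: contrapT => hn; apply: (main (Neg phi) hn).
exists (s \o c \o @unsplit _ _ \o inr).
apply: (dom U id (@elementary_id L U) a) => // phi /hr.
rewrite -(elementary_sat _ phi (automorphism_elementary aut_s)) join_comp.
set v := join _ _; set w := join _ _; suff -> : v = w by [].
apply: funext => -[[i|i]|u] //=; first by rewrite -sE.
by apply: fix_s; apply: set_mem; apply: valP.
Qed.

End Monster.
(** * Classification of definable types up to domination *)

Section Classification.
Variables (L : language) (O : oring_symbols L) (U : structure L) (K : Type).
Hypothesis U_monster : monster K U.
Local Notation ext := (ext U).
Hypothesis model : forall I : ext, rcf_model O I.
Hypothesis omin : forall I : ext, ominimal O I.

Let K_limit : strong_limit K. Proof. by case: U_monster. Qed.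
Let K_large : theory_small K L. Proof. by case: U_monster. Qed.

Lemma dfn_all_tuple (A : set U) V m (R : forall I : ext, (V -> I) -> ('I_m -> I) -> Prop) :
  dfn A (fun I (v : V + 'I_m -> I) => R I (v \o inl) (v \o inr)) ->
  dfn A (fun I v => forall z : 'I_m -> I, R I v z).
Proof.
move=> [phi h].
pose f (x : V + 'I_m + A) : 'I_m + (V + A) := match x with
  inl (inl v) => inr (inl v) | inl (inr i) => inl i | inr a => inr (inr a) end.
have [sigma hs] := universal_closure (rename f phi).
exists sigma => I v; rewrite hs.
have E z : sat (join z (join v (emb I \o @set_val U A))) (rename f phi) <-> R I v z.
  rewrite sat_rename -[R I v z]/(R I (join v z \o inl) (join v z \o inr)) h.
  rewrite (_ : _ \o f = join (join v z) (emb I \o @set_val U A)) //.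
  by apply: funext => -[[]|].
by split=> hz z; apply/E; apply: hz.
Qed.

Lemma nonrealised_dominates (p q : gset U) : definable_type K p -> definable_type K q ->
  ~ realised p -> dominates K p q.
Proof.
move=> dp dq.
(* The order matters: [c] realises [q] generically over the model [N] that contains the realisation
   [b] of [p]. *)
have [A [N [J [j [c [b [sA hj [hq hp] [hb hc] [hcq _]]]]]]]] :=
  tensor_realisation U_monster dq dp.
rewrite (realised_tuple hb) => /existsNP[y0 hy0].
have b_nonstandard u : b y0 <> emb N u by move=> e; apply: hy0; exists u.
exists A, [set phi | sat (join (join (j \o b) c) (emb J \o @set_val U A)) phi]; split.
- exact: sA.
- exact: sum_type_complete.
- move=> phi /hb h /=; rewrite sat_vrename.
  rewrite (_ : join _ _ = j \o join b (emb N \o @set_val U A)).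
    rewrite (elementary_sat _ _ (ext_hom_elementary hj)).
    by move: h; rewrite sat_prename.
  by apply: funext => -[x|u] //=; rewrite -(ext_hom_emb hj).
- by move=> phi /hcq h /=; rewrite sat_vrename; move: h; rewrite sat_prename.
move=> N' e he a b' ha hab phi; pose I' := Ext he.
have [m [phi0 [d [_ ->]]]] := finite_support phi => qphi.
have [chi hchi] := definable_scheme phi0 hq.
(* [R] collects the parameters at which [phi0] fails although the scheme [chi] of [q] demands it.
   There are none in [U], since [c] realises [q]. *)
pose R (I : ext) (v : 'I_(gdim q) + ('I_(gdim p) + 'I_m) -> I) :=
  ~ (sat (join (v \o inr \o inr) (emb I \o @set_val U A)) chi ->
     sat (join (v \o inl) (v \o inr \o inr)) phi0).
have dfn_R : dfn A R.
  apply: dfn_not; apply: dfn_imp.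
    by exists (vrename (inr \o inr) chi) => I v; rewrite sat_vrename.
  exists (rename (join (inl \o inl) (inl \o inr \o inr)) phi0) => I v.
  rewrite sat_rename (_ : _ \o join _ _ = join (v \o inl) (v \o inr \o inr)) //.
  by apply: funext => -[].
have emb_chi (I : ext) (u : 'I_m -> U) :
    sat (join (emb I \o u) (emb I \o @set_val U A)) chi <-> sat (join u (@set_val U A)) chi.
  by rewrite -join_comp elementary_sat //; apply: embP.
have [|R' [dfn_R' R'_exit R'_cover]] := core model omin hj
    (fun Z R => heir_dfn hq hj hc (R := R)) (gtp_definable_tuple hp hb) b_nonstandard dfn_R.
  move=> u; apply=> /emb_chi /hchi /hcq.
  by rewrite sat_prename.
(* That [R'] covers [R] is a single formula over [A] true of [b] and [c], hence it belongs to [r]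
   and holds of [a] and [b']. *)
have [theta htheta] : dfn A (fun (I : ext) (v : 'I_(gdim p) + 'I_(gdim q) -> I) =>
    forall z : 'I_m -> I, R I (join (v \o inr) (join (v \o inl) z)) ->
                          R' I (join (v \o inl) z)).
  apply: dfn_all_tuple; apply: dfn_imp.
    apply: (dfn_app (f := fun x => match x with inl x => inl (inr x)
      | inr (inl y) => inl (inl y) | inr (inr i) => inr i end) dfn_R).
    by move=> I v [x|[y|i]].
  apply: (dfn_app (f := fun x => match x with inl y => inl (inl y)
    | inr i => inr i end) dfn_R').
  by move=> I v [y|i].
have Jtheta : sat (join (join (j \o b) c) (emb J \o @set_val U A)) theta.
  by apply/htheta => z; exact: R'_cover.
have /(htheta I' (join a b')) /(_ (e \o d)) hI' := hab _ Jtheta.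
(* With the parameters [d] from [U], the failure of [R'] at [b] is part of [p], which [a]
   realises. *)
have nR' : ~ R' I' (join a (e \o d)).
  have [rho' hrho'] := dfn_R'.
  pose f (x : 'I_(gdim p) + 'I_m + A) : 'I_(gdim p) + U := match x with
    inl (inl y) => inl y | inl (inr i) => inr (d i) | inr u => inr (set_val u) end.
  have E (I : ext) (y : 'I_(gdim p) -> I) :
      R' I (join y (emb I \o d)) <-> sat (join y (emb I)) (rename f rho').
    rewrite hrho' sat_rename (_ : _ \o f = join (join y (emb I \o d)) (emb I \o @set_val U A)) //.
    by apply: funext => -[[]|].
  rewrite (E I' a); apply: (ha (Neg (rename f rho'))); apply/hb/sat_neg.
  by rewrite -E.
rewrite sat_prename; apply: contrapT => nphi; apply/nR'/hI' => h.
apply: nphi; apply: h; apply/(emb_chi I')/hchi.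
exact: qphi.
Qed.

(** With the realisation [b] of [q] as the small set, [r] contains the equations that fix the second
    tuple to be [b]. *)
Lemma realised_dominates (p q : gset U) : global_type p -> global_type q ->
  realised p -> realised q -> dominates K p q.
Proof.
move=> [_ p_cpl] [_ q_cpl] [a ha] [b hb].
have p_of phi : sat (join a id) phi -> gforms p phi.
  by move=> h; have [//|/ha hn] := p_cpl phi; case: (hn h).
pose A := range b.
have sA : small K A.
  by apply: (finite_small K_large); apply: finite_image; apply: finite_finset.
exists A, [set phi | sat (join (join a b) (emb ext0 \o @set_val U A)) phi]; split.
- exact: sA.
- exact: (@sum_type_complete _ _ A ext0).
- by move=> phi /ha; rewrite /= sat_prename sat_vrename.
- by move=> phi /hb; rewrite /= sat_prename sat_vrename.
move=> N e he a' b' _ hab phi /hb h.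
have hA i : b i \in A by apply/mem_set; exists i.
have -> : b' = e \o b.
  apply: funext => i.
  exact: (hab (Equ (Var L (inl (inr i))) (Var L (inr (SigSub (hA i))))) erefl).
rewrite -[e in X in join _ X]/(e \o id) -join_comp.
exact/elementary_sat.
Qed.

(** The claims about the quotient reduce through this equivalence to propositional statements about
    being realised. *)
Lemma dominatesE (p q : gset U) : definable_type K p -> definable_type K q ->
  dominates K p q <-> (realised p -> realised q).
Proof.
move=> dp dq; split=> [|h]; first exact: (dominates_realised U_monster dp.1).
have [rp|nrp] := pselect (realised p); last exact: nonrealised_dominates.
by apply: realised_dominates; [exact: dp.1|exact: dq.1|exact: rp|exact: h].
Qed.

Lemma dom_equivE (p q : gset U) : definable_type K p -> definable_type K q ->
  dom_equiv K p q <-> (realised p <-> realised q).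
Proof. by move=> dp dq; rewrite /dom_equiv !dominatesE //; split=> -[]. Qed.

(** The type at plus infinity: a formula belongs to it if it holds for all large elements, a
    condition that is itself first order without parameters. *)
Lemma nonrealised_definable_exists : exists p : gset U, definable_type K p /\ ~ realised p.
Proof.
pose P := [set phi : formula L ('I_1 + U) |
  exists u : U, forall x : U, mlt O u x -> sat (join (app1 x) id) phi].
exists (@GSet L U 1 P); split; last first.
  move=> [a ha].
  have := ha (Neg (Equ (Var L (inl ord0)) (Var L (inr (a ord0))))).
  apply=> //; exists (a ord0) => x /(mltE (model ext0)) ax /= e.
  by move: ax; rewrite -[x]/(app1 x ord0) e ltxx.
split.
  split=> [F finF FP|phi] /=.
    pose le (x y : U) : Prop := (rho (model ext0) x <= rho (model ext0) y)%R.
    have le_tr x y z : le x y -> le y z -> le x z by exact: le_trans.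
    have le_dir x y : exists z, le x z /\ le y z.
      rewrite /le; have [h|/ltW h] := leP (rho (model ext0) x) (rho (model ext0) y).
        by exists y.
      by exists x.
    have [|u hu] := eventually_finite (mzero O U) le_tr le_dir finF
      (P := fun phi u => forall x : U, mlt O u x -> sat (join (app1 x) id) phi).
      move=> phi /FP[u hu]; exists u => u' uu' x /(mltE (model ext0)) u'x.
      by apply: hu; apply/(mltE (model ext0)); apply: le_lt_trans u'x.
    have [x ux] := mabove (model ext0) u.
    exists (app1 x) => phi Fphi; apply: (hu u (lexx _) _ Fphi).
    exact/(mltE (model ext0)).
  have [|u [h|h]] := @eventually_constant L O U (model ext0) (@omin ext0)
    [set x | sat (join (app1 x) id) phi].
  - by exists phi.
  - by left; exists u.
  - by right; exists u.
exists set0; split; first exact: (finite_small K_large (finite_set0 _)).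
move=> m phi /=.
have [psi hpsi] : dfn set0 (fun (I : ext) (v : 'I_m -> I) => exists u : I, forall x : I,
    mlt O u x -> sat (join (app1 x) v) phi).
  apply: dfn_ex; apply: dfn_all; apply: dfn_imp.
    by apply: dfn_lt; exact: tdfn_var.
  apply: (dfn_app (R := fun (I : ext) (v : 'I_1 + 'I_m -> I) => sat v phi)
    (f := fun x => match x with inl _ => None | inr i => Some (Some i) end)).
    by exists (rename inl phi) => I v; rewrite sat_rename.
  by move=> I v [].
exists psi => d; rewrite -(hpsi ext0 d) /P /=.
by split=> -[u hu]; exists u => x /hu; rewrite sat_prename.
Qed.

(** The type of the empty tuple is realised and definable over the empty set; its class will be the
    neutral element. *)
Lemma realised_definable_exists : exists p : gset U, definable_type K p /\ realised p.
Proof.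
pose c (i : 'I_0) : U := match notF (ltn_ord i) with end.
exists (@gtp _ _ ext0 0 c); split; last by apply/realised_gtp; exists c.
split; first exact: gtp_global.
exists set0; split; first exact: (finite_small K_large (finite_set0 _)).
move=> m phi; exists (rename (join (fun i : 'I_0 => match notF (ltn_ord i) with end) inl) phi).
move=> d; rewrite /= sat_prename sat_rename.
by rewrite (_ : _ \o join _ _ = join c (emb ext0 \o d)) //; apply: funext => -[[]|].
Qed.

Lemma dclassE (p q : gset U) : definable_type K p ->
  dclass K p q <-> definable_type K q /\ (realised p <-> realised q).
Proof.
by move=> dp; split=> -[dq h]; split=> //; apply/dom_equivE.
Qed.

Lemma dclass_eq (p q : gset U) : definable_type K p -> definable_type K q ->
  (realised p <-> realised q) -> dclass K p = dclass K q.
Proof.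
move=> dp dq pq; apply/seteqP; split=> r.
  by move=> /(dclassE _ dp)[dr h]; apply/(dclassE _ dq); split=> //; tauto.
by move=> /(dclassE _ dq)[dr h]; apply/(dclassE _ dp); split=> //; tauto.
Qed.

Lemma cmul_dclass (p q : gset U) : definable_type K p -> definable_type K q ->
  cmul K (dclass K p) (dclass K q) = dclass K (tensor K p q).
Proof.
move=> dp dq; have dpq := tensor_definable U_monster dp dq.
apply/seteqP; split=> r.
  move=> [dr [p' [q' [/dclassE[] // dp' pp' /dclassE[] // dq' qq']]]].
  have dpq' := tensor_definable U_monster dp' dq'.
  move/(dom_equivE dpq' dr) => h; apply/dclassE => //; split=> //; rewrite -h.
  by rewrite !(tensor_realised U_monster) // pp' qq'.
move=> /dclassE[] // dr h; split=> //; exists p, q; split.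
- exact/dclassE.
- exact/dclassE.
exact/dom_equivE.
Qed.

Lemma definable_monoid : Deftilde_monoid K U.
Proof.
have dT := tensor_definable U_monster; have rT := tensor_realised U_monster.
split.
- move=> q p0 p1 dq d0 d1; rewrite !dominatesE //; try exact: dT.
  by rewrite !rT // => h [rq /h].
- by move=> p q dp dq; split; [exact: dT|exact: cmul_dclass].
- move=> _ _ _ [p dp <-] [q dq <-] [r dr <-].
  rewrite !cmul_dclass //; try exact: dT.
  have dqr := dT _ _ dq dr; have dpq := dT _ _ dp dq.
  apply: dclass_eq; [exact: dT|exact: dT|].
  by rewrite !rT //; tauto.
have [e [de re]] := realised_definable_exists.
exists (dclass K e); first by exists e.
move=> _ [p dp <-]; rewrite !cmul_dclass //.
by split; apply: dclass_eq => //; try exact: dT; rewrite rT //; tauto.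
Qed.

Lemma definable_iso : exists f : set (gset U) -> set nat, Deftilde_iso_powerset K f.
Proof.
have dT := tensor_definable U_monster; have rT := tensor_realised U_monster.
(* The class of the realised types goes to the empty set, and that of the non-realised ones to
   [{0}]. *)
pose f (X : set (gset U)) : set nat := [set n | n = 0%N /\ ~ exists2 p, X p & realised p].
have fE p n : definable_type K p -> f (dclass K p) n <-> n = 0%N /\ ~ realised p.
  move=> dp; split=> -[n0 h]; split=> //.
    by move=> rp; apply: h; exists p => //; apply/dclassE.
  by move=> [q /dclassE[] // dq <-].
exists f; split.
- split=> [X _ n [-> _] //|X Y|S S0].
    move=> /set_mem[p dp <-] /set_mem[q dq <-] e; apply: dclass_eq => //.
    have := fE p 0%N dp; rewrite e fE //.
    by have [] := pselect (realised p); have [] := pselect (realised q); tauto.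
  have [n [dn nrn]] := nonrealised_definable_exists.
  have [e [de re]] := realised_definable_exists.
  have [h|h] := pselect (S 0%N); [exists (dclass K n)|exists (dclass K e)].
  + by exists n.
  + apply/seteqP; split=> k; first by move=> /fE[] // ->.
    by move=> /S0 ->; apply/fE.
  + by exists e.
  apply/seteqP; split=> k; first by move=> /fE[].
  by move=> Sk; have k0 := S0 k Sk; move: Sk; rewrite k0 => /h.
- move=> _ _ [p dp <-] [q dq <-]; rewrite cmul_dclass //.
  apply/seteqP; split=> n.
    move=> /fE[|-> ]; first exact: dT.
    rewrite rT // => h; have [rp|nrp] := pselect (realised p); last by left; apply/fE.
    by right; apply/fE => //; split=> // rq; apply: h.
  by case=> /fE[] // -> h; apply/fE; [exact: dT| |exact: dT|]; split=> //; rewrite rT // => -[].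
move=> _ _ [p dp <-] [q dq <-]; split.
  move=> [p' [q' [/dclassE[] // dp' pp' /dclassE[] // dq' qq' /dominatesE h]]].
  move=> n /fE[] // -> nq; apply/fE => //; split=> // rp; apply: nq.
  by apply/qq'; apply: h => //; apply/pp'.
move=> sub; exists p, q; split; [exact/dclassE|exact/dclassE|].
apply/dominatesE => // rp; apply: contrapT => nq.
have : f (dclass K q) 0%N by apply/fE.
by move=> /sub /fE[].
Qed.

End Classification.
Theorem theorem3p8 (L : language) (O : oring_symbols L) (T : set (sentence L))
    (K : Type) (U : structure L)
    (T_complete : complete_theory T)
    (T_RCF : expands_RCF O T)
    (T_ominimal : ominimal_theory O T)
    (U_model : models U T)
    (U_monster : monster K U) :
  (forall p q : gset U,
     definable_type K p -> definable_type K q ->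
     ~ realised p -> ~ realised q -> dom_equiv K p q) /\
  Deftilde_monoid K U /\
  exists f : set (gset U) -> set nat, Deftilde_iso_powerset K f.
Proof.
have N_model (I : ext U) : models I T := elementary_models (embP I) U_model.
have omin (I : ext U) : ominimal O I by apply: T_ominimal.
pose model (I : ext U) : rcf_model O I :=
  projT1 (cid (rcf_model_exists (T_RCF I (N_model I)))).
split=> [p q dp dq np nq|].
  by apply/(dom_equivE U_monster model omin dp dq).
split; first exact: (definable_monoid U_monster model omin).
exact: (definable_iso U_monster model omin).
Qed.
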